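(* Let $0<\eta<T$, $0<\alpha<\frac{2T}{\eta^2}$ and $0\le\beta<\frac{2T-\alpha\eta^2}{\alpha\eta^2-2\eta+2T}$ be real constants. Let $f\in C([0,\infty),[0,\infty))$, and let $a\in C([0,T],[0,\infty))$ be such that there exists $t_0\in[\eta,T]$ with $a(t_0)>0$. Let $\Lambda_1$ be the constant defined in the context. Assume that (i) $\lim_{u\to0^+}\frac{f(u)}{u}=\infty$ and $\lim_{u\to\infty}\frac{f(u)}{u}=\infty$; (ii) there exist constants $\rho_1>0$ and $M_1\in(0,\Lambda_1]$ such that $f(u)\le M_1\rho_1$ for all $u\in[0,\rho_1]$. Then the boundary value problem $$u''(t)+a(t)f(u(t))=0,\quad 0<t<T,\qquad u(0)=\beta u(\eta),\quad u(T)=\alpha\int_0^\eta u(s)\,ds,$$ has at least two positive solutions $u_1$ and $u_2$ such that $0<\|u_1\|<\rho_1<\|u_2\|$.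
   Context: $\|u\|=\max_{t\in[0,T]}|u(t)|$ is the sup norm on $C([0,T],\mathbb{R})$. A positive solution of the boundary value problem is a function $u\in C([0,T])$, twice continuously differentiable on $(0,T)$, satisfying the differential equation on $(0,T)$ and both boundary conditions, with $u(t)\ge0$ on $[0,T]$ and $u(t)>0$ for $t\in(0,T)$. Define $$\Lambda_1=\frac{(2T-\alpha\eta^2)-\beta(\alpha\eta^2-2\eta+2T)}{\left[2(\beta+1)+T^{-1}\beta\eta(\alpha\eta+2)+\alpha\beta T\right]\int_0^T T(T-s)a(s)\,ds}.$$ *)

(* Defs.v *)
From Stdlib Require Import Reals.
From Coquelicot Require Import Coquelicot.
Open Scope R_scope.

(* Functions on an interval are total functions [R -> R]; only their values on
   that interval are constrained, and continuity is relative to it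
   ([continuous_on] uses the filter [within]), hence one-sided at endpoints. *)
Definition Icc (x y : R) : R -> Prop := fun t => x <= t <= y.
Definition Ici (x : R) : R -> Prop := fun t => x <= t.

(* The supremum over [0,T], which for [T >= 0] is the maximum when [u] is
   continuous on [0,T]. *)
Definition sup_norm (T : R) (u : R -> R) : R :=
  real (Lub_Rbar (fun y => exists t, Icc 0 T t /\ y = Rabs (u t))).

Definition twice_cont_diff_on_open (x y : R) (u : R -> R) : Prop :=
  forall t, x < t < y ->
    ex_derive u t /\ ex_derive (Derive u) t /\ continuous (Derive_n u 2) t.

Definition is_solution (T eta alpha beta : R) (a f u : R -> R) : Prop :=
  continuous_on (Icc 0 T) u /\
  twice_cont_diff_on_open 0 T u /\
  (forall t, 0 < t < T -> Derive_n u 2 t + a t * f (u t) = 0) /\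
  u 0 = beta * u eta /\
  u T = alpha * RInt u 0 eta.

Definition is_positive_solution (T eta alpha beta : R) (a f u : R -> R) : Prop :=
  is_solution T eta alpha beta a f u /\
  (forall t, Icc 0 T t -> 0 <= u t) /\
  (forall t, 0 < t < T -> 0 < u t).

Definition Lambda1 (T eta alpha beta : R) (a : R -> R) : R :=
  ((2 * T - alpha * eta ^ 2) - beta * (alpha * eta ^ 2 - 2 * eta + 2 * T)) /
  ((2 * (beta + 1) + / T * beta * eta * (alpha * eta + 2) + alpha * beta * T) *
   RInt (fun s => T * (T - s) * a s) 0 T).

(* Main.v *)
Require Import Defs.
From Stdlib Require Import Reals Lra Lia Classical Bool IndefiniteDescription.
From mathcomp Require filter.
From Coquelicot Require Import Coquelicot.
Open Scope R_scope.

(* Shooting with two parameters: the maximum [m] of the trajectory and the place [tau] where it is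
   attained ([tau] outside [[0, T]] encodes a nonzero slope at an endpoint). The condition at [0]
   has opposite signs for [tau] very negative and very large. When it holds, the defect
   [u T - alpha * RInt u 0 eta] is negative for [m] small and for [m] large (superlinearity), and
   positive for [m = rho1] (hypothesis (ii)), so the planar Poincare-Miranda theorem applies for
   [m] between a small value and [rho1] and again for [m] between [rho1] and a large value. As [f]
   is only continuous, it is applied to trajectories of a delayed equation, which depend
   continuously on the parameters, and the delay tends to 0 by compactness. *)

(** * Poincare-Miranda theorem on a rectangle *)

(** The parameter [m] is the maximum of the trajectory, hence the sup norm of a nonnegative one, so
    the position of the norm relative to [rho1] is read off the range of [m], and [f] is evaluated
    only on [[0, m]], which makes its truncation harmless. The obstacle is that the signs of the
    right defect at the extreme values of [m] come from the exact equation together with the exact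
    condition at [0]; they are not known along a whole side of the rectangle, nor for a delayed
    trajectory. Hence no sign is imposed on those sides. The approximate result gives an alternative
    instead: the right defect is small, or [m] is extreme and the defect has, up to the tolerance,
    the sign to be excluded. This alternative survives the vanishing of the delay, and only
    afterwards do the sign estimates rule out the extreme values. These estimates rest on the
    concavity of trajectories with nonnegative forcing. At [rho1] the estimate asks for
    [2 * (beta + 1) * T * w <= rho1 * D], with [D] the determinant [bvp_det] and [w] a bound for the
    forcing integral; [Lambda1] provides it because the bracket in its denominator is at least
    [2 * (beta + 1)]. *)

(** Sperner colouring by two signs: the three colours are [p], then [q] without [p], then neither.
    The marked edges join the last two colours. *)
Definition split_edge {X : Type} (p q : X -> bool) (x y : X) : bool :=
  negb (p x) && negb (p y) && xorb (q x) (q y).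

Definition rainbow {X : Type} (p q : X -> bool) (D : X -> Prop) : Prop :=
  exists u v w, D u /\ D v /\ D w /\
    p u = true /\ (p v = false /\ q v = true) /\ (p w = false /\ q w = false).

(** Sperner parity: a triangle that misses one of the colours has zero or two marked edges, so an
    odd number forces all three colours. *)
Lemma rainbow_triangle {X : Type} (p q : X -> bool) (D : X -> Prop) (x y z : X) :
  D x -> D y -> D z ->
  xorb (split_edge p q x y) (xorb (split_edge p q y z) (split_edge p q x z)) = true ->
  rainbow p q D.
Proof.
  intros Dx Dy Dz. unfold split_edge, rainbow.
  destruct (p x) eqn:px, (p y) eqn:py, (p z) eqn:pz; simpl; try discriminate;
    destruct (q x) eqn:qx, (q y) eqn:qy, (q z) eqn:qz; simpl; try discriminate;
    intros _;
    ((exists x, y, z; now repeat split) || (exists x, z, y; now repeat split) ||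
     (exists y, x, z; now repeat split) || (exists y, z, x; now repeat split) ||
     (exists z, x, y; now repeat split) || (exists z, y, x; now repeat split)).
Qed.

Definition cell (i j : nat) (z : nat * nat) : Prop :=
  (i <= fst z <= S i)%nat /\ (j <= snd z <= S j)%nat.

Fixpoint column_parity (p q : nat * nat -> bool) (i n : nat) : bool :=
  match n with
  | O => false
  | S j => xorb (column_parity p q i j) (split_edge p q (i, j) (i, S j))
  end.

(** The diagonal belongs to both triangles of the cell, so it cancels when their two parities are
    added. *)
Lemma cell_parity (p q : nat * nat -> bool) (i j : nat) :
  ~ rainbow p q (cell i j) ->
  xorb (xorb (split_edge p q (i, j) (i, S j)) (split_edge p q (S i, j) (S i, S j)))
       (xorb (split_edge p q (i, j) (S i, j)) (split_edge p q (i, S j) (S i, S j)))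
  = false.
Proof.
  intros H.
  assert (D00 : cell i j (i, j)) by (split; simpl; lia).
  assert (D01 : cell i j (i, S j)) by (split; simpl; lia).
  assert (D10 : cell i j (S i, j)) by (split; simpl; lia).
  assert (D11 : cell i j (S i, S j)) by (split; simpl; lia).
  pose proof (rainbow_triangle p q (cell i j) (i, j) (i, S j) (S i, S j) D00 D01 D11) as H1.
  pose proof (rainbow_triangle p q (cell i j) (i, j) (S i, j) (S i, S j) D00 D10 D11) as H2.
  destruct (split_edge p q (i, j) (i, S j)), (split_edge p q (S i, j) (S i, S j)),
    (split_edge p q (i, j) (S i, j)), (split_edge p q (i, S j) (S i, S j)),
    (split_edge p q (i, j) (S i, S j)); simpl in *; try reflexivity;
    exfalso; apply H; auto.
Qed.

(** Without a rainbow cell the parity of marked edges is the same on every column, since [q] is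
    constant along the two sides [j = 0] and [j = N] and these carry no marked edge. It is even on
    the column [0], where [p] holds, and odd on the column [N], where [p] fails and [q] passes from
    false to true. *)
Lemma rainbow_cell (p q : nat * nat -> bool) (N : nat) :
  (forall j, (j <= N)%nat -> p (0, j)%nat = true) ->
  (forall j, (j <= N)%nat -> p (N, j)%nat = false) ->
  (forall i, (i <= N)%nat -> q (i, 0)%nat = false) ->
  (forall i, (i <= N)%nat -> q (i, N)%nat = true) ->
  exists i j, (i < N)%nat /\ (j < N)%nat /\ rainbow p q (cell i j).
Proof.
  intros Hp0 HpN Hq0 HqN. apply NNPP. intros Hno.
  assert (Hcell : forall i j, (i < N)%nat -> (j < N)%nat -> ~ rainbow p q (cell i j))
    by (intros i j Hi Hj Hr; apply Hno; exists i, j; auto).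
  assert (Hstep : forall i j, (i < N)%nat -> (j <= N)%nat ->
    xorb (column_parity p q i j) (column_parity p q (S i) j) =
    xorb (split_edge p q (i, 0)%nat (S i, 0)%nat) (split_edge p q (i, j) (S i, j))).
  { intros i j Hi. induction j as [|j IH]; intros Hj; simpl.
    - now rewrite xorb_nilpotent.
    - pose proof (cell_parity p q i j (Hcell i j Hi ltac:(lia))) as Hc.
      specialize (IH ltac:(lia)).
      destruct (column_parity p q i j), (column_parity p q (S i) j),
        (split_edge p q (i, 0)%nat (S i, 0)%nat), (split_edge p q (i, j) (S i, j)),
        (split_edge p q (i, j) (i, S j)), (split_edge p q (S i, j) (S i, S j)),
        (split_edge p q (i, S j) (S i, S j)); simpl in *; congruence. }
  assert (Hconst : forall i, (i <= N)%nat -> column_parity p q i N = column_parity p q 0 N).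
  { induction i as [|i IH]; intros Hi; [reflexivity|].
    specialize (Hstep i N ltac:(lia) ltac:(lia)). rewrite <- IH by lia.
    unfold split_edge in Hstep.
    rewrite !Hq0, !HqN in Hstep by lia. simpl in Hstep.
    rewrite !andb_false_r in Hstep. simpl in Hstep.
    destruct (column_parity p q i N), (column_parity p q (S i) N); simpl in *; congruence. }
  assert (H0 : forall j, (j <= N)%nat -> column_parity p q 0 j = false).
  { induction j as [|j IH]; intros Hj; [reflexivity|]. simpl.
    rewrite IH by lia. unfold split_edge. now rewrite Hp0 by lia. }
  assert (HN : forall j, (j <= N)%nat -> column_parity p q N j = q (N, j)).
  { induction j as [|j IH]; intros Hj; simpl.
    - now rewrite Hq0 by lia.
    - rewrite IH by lia. unfold split_edge. rewrite !HpN by lia. simpl.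
      destruct (q (N, j)), (q (N, S j)); reflexivity. }
  specialize (Hconst N (le_n N)). rewrite HN, H0, HqN in Hconst by lia. discriminate.
Qed.

Definition unif_cont2 (x0 x1 y0 y1 : R) (g : R -> R -> R) : Prop :=
  forall e, 0 < e -> exists d, 0 < d /\
    forall x y x' y', x0 <= x <= x1 -> y0 <= y <= y1 -> x0 <= x' <= x1 -> y0 <= y' <= y1 ->
      Rabs (x - x') <= d -> Rabs (y - y') <= d -> Rabs (g x y - g x' y') <= e.

Definition Rpos_b (x : R) : bool := if Rlt_dec 0 x then true else false.

Lemma Rpos_b_true x : Rpos_b x = true <-> 0 < x.
Proof. unfold Rpos_b; destruct (Rlt_dec 0 x); split; intros; easy. Qed.

Lemma Rpos_b_false x : Rpos_b x = false <-> x <= 0.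
Proof. unfold Rpos_b; destruct (Rlt_dec 0 x); split; intros; try easy; lra. Qed.

Lemma grid_in (x0 x1 : R) (N i : nat) :
  x0 <= x1 -> (0 < N)%nat -> (i <= N)%nat -> x0 <= x0 + INR i * ((x1 - x0) / INR N) <= x1.
Proof.
  intros Hx HN Hi. apply lt_0_INR in HN as HN'. apply le_INR in Hi.
  pose proof (pos_INR i).
  assert (Hq : INR i / INR N <= 1) by (apply Rle_div_l; lra).
  assert (0 <= INR i / INR N) by (apply Rdiv_le_0_compat; lra).
  replace (INR i * ((x1 - x0) / INR N)) with (INR i / INR N * (x1 - x0)) by (field; lra).
  split; nra.
Qed.

Lemma grid_close (x0 s d : R) (i a b : nat) :
  0 <= s <= d -> (i <= a <= S i)%nat -> (i <= b <= S i)%nat ->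
  Rabs ((x0 + INR a * s) - (x0 + INR b * s)) <= d.
Proof.
  intros Hs Ha Hb.
  replace (x0 + INR a * s - (x0 + INR b * s)) with ((INR a - INR b) * s) by ring.
  rewrite Rabs_mult, (Rabs_pos_eq s) by lra.
  assert (Rabs (INR a - INR b) <= 1).
  { assert (a = i \/ a = S i) as [-> | ->] by lia; assert (b = i \/ b = S i) as [-> | ->] by lia;
      rewrite ?S_INR; apply Rabs_le; lra. }
  pose proof (Rabs_pos (INR a - INR b)). nra.
Qed.

(** A cell of a fine grid with vertices of all three colours contains a sign change of [g] and one
    of [h]; uniform continuity then makes both small there. *)
Lemma poincare_miranda_approx (g h : R -> R -> R) (x0 x1 y0 y1 e : R) :
  x0 < x1 -> y0 < y1 -> unif_cont2 x0 x1 y0 y1 g -> unif_cont2 x0 x1 y0 y1 h ->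
  (forall x, x0 <= x <= x1 -> 0 < g x y0) -> (forall x, x0 <= x <= x1 -> g x y1 < 0) ->
  (forall y, y0 <= y <= y1 -> h x0 y < 0) -> (forall y, y0 <= y <= y1 -> 0 < h x1 y) ->
  0 < e ->
  exists x y, x0 <= x <= x1 /\ y0 <= y <= y1 /\ Rabs (g x y) <= e /\ Rabs (h x y) <= e.
Proof.
  intros Hx Hy Ug Uh Hg0 Hg1 Hh0 Hh1 He.
  destruct (Ug e He) as [d1 [Hd1 Kg]]. destruct (Uh e He) as [d2 [Hd2 Kh]].
  set (d := Rmin d1 d2).
  assert (Hd : 0 < d) by (apply Rmin_pos; assumption).
  assert (Hdd : d <= d1 /\ d <= d2) by (split; [apply Rmin_l|apply Rmin_r]).
  destruct (archimed_cor1 (d / (x1 - x0 + (y1 - y0)))) as [N [HN HN0]].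
  { apply Rdiv_lt_0_compat; lra. }
  assert (HNR : 0 < INR N) by (now apply lt_0_INR).
  assert (HS : (x1 - x0 + (y1 - y0)) / INR N <= d).
  { apply Rlt_le, Rlt_div_l; [lra|]. apply Rlt_div_r in HN; [|lra].
    apply (Rmult_lt_compat_r (INR N)) in HN; [|lra].
    replace (/ INR N * (x1 - x0 + (y1 - y0)) * INR N) with (x1 - x0 + (y1 - y0)) in HN by (field; lra).
    exact HN. }
  assert (Hs : 0 <= (x1 - x0) / INR N <= d /\ 0 <= (y1 - y0) / INR N <= d).
  { assert (0 <= (x1 - x0) / INR N) by (apply Rdiv_le_0_compat; lra).
    assert (0 <= (y1 - y0) / INR N) by (apply Rdiv_le_0_compat; lra).
    assert ((x1 - x0 + (y1 - y0)) / INR N = (x1 - x0) / INR N + (y1 - y0) / INR N) by (field; lra).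
    lra. }
  set (X := fun j : nat => x0 + INR j * ((x1 - x0) / INR N)).
  set (Y := fun i : nat => y0 + INR i * ((y1 - y0) / INR N)).
  assert (HX : forall j, (j <= N)%nat -> x0 <= X j <= x1) by (intros; apply grid_in; lra || lia).
  assert (HY : forall j, (j <= N)%nat -> y0 <= Y j <= y1) by (intros; apply grid_in; lra || lia).
  assert (X0 : X 0%nat = x0) by (unfold X; simpl; ring).
  assert (Y0 : Y 0%nat = y0) by (unfold Y; simpl; ring).
  assert (XN : X N = x1) by (unfold X; field; lra).
  assert (YN : Y N = y1) by (unfold Y; field; lra).
  (* The first grid index runs along [y], between the sides on which [g] has opposite signs; the
     second runs along [x], where [h] does. *)
  destruct (rainbow_cell (fun z => Rpos_b (g (X (snd z)) (Y (fst z))))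
                         (fun z => Rpos_b (h (X (snd z)) (Y (fst z)))) N)
    as [i [j [Hi [Hj [[u1 u2] [[v1 v2] [[w1 w2] [[Du1 Du2] [[Dv1 Dv2] [[Dw1 Dw2]
        [Pu [[Pv Qv] [Pw Qw]]]]]]]]]]]]]; simpl in *.
  - intros k Hk; simpl. rewrite Y0. now apply Rpos_b_true, Hg0, HX.
  - intros k Hk; simpl. rewrite YN. apply Rpos_b_false, Rlt_le, Hg1, HX, Hk.
  - intros k Hk; simpl. rewrite X0. apply Rpos_b_false, Rlt_le, Hh0, HY, Hk.
  - intros k Hk; simpl. rewrite XN. now apply Rpos_b_true, Hh1, HY.
  - apply Rpos_b_true in Pu, Qv. apply Rpos_b_false in Pv, Pw, Qw.
    (* The vertex of the middle colour has [g <= 0] and [h > 0]: comparison with [u], where [g > 0],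
       bounds [g], and comparison with [w], where [h <= 0], bounds [h]. *)
    exists (X v2), (Y v1).
    assert (G : Rabs (g (X u2) (Y u1) - g (X v2) (Y v1)) <= e).
    { apply Kg; try (apply HX; lia); try (apply HY; lia);
        (eapply Rle_trans; [eapply grid_close; [|eassumption|eassumption]; apply Hs|lra]). }
    assert (H : Rabs (h (X v2) (Y v1) - h (X w2) (Y w1)) <= e).
    { apply Kh; try (apply HX; lia); try (apply HY; lia);
        (eapply Rle_trans; [eapply grid_close; [|eassumption|eassumption]; apply Hs|lra]). }
    apply Rabs_le_between in G, H.
    split; [apply HX; lia|]. split; [apply HY; lia|].
    split; apply Rabs_le; lra.
Qed.

Definition clamp (lo hi x : R) : R := Rmax lo (Rmin hi x).

Lemma clamp_in lo hi x : lo <= hi -> lo <= clamp lo hi x <= hi.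
Proof. intros; unfold clamp, Rmax, Rmin; repeat destruct Rle_dec; lra. Qed.

Lemma clamp_id lo hi x : lo <= x <= hi -> clamp lo hi x = x.
Proof. intros; unfold clamp, Rmax, Rmin; repeat destruct Rle_dec; lra. Qed.

Lemma clamp_lip lo hi x y : Rabs (clamp lo hi x - clamp lo hi y) <= Rabs (x - y).
Proof.
  unfold clamp, Rmax, Rmin, Rabs; repeat destruct Rle_dec; repeat destruct Rcase_abs; lra.
Qed.

Lemma sub_clamp_lip lo hi x y :
  Rabs ((x - clamp lo hi x) - (y - clamp lo hi y)) <= Rabs (x - y).
Proof.
  unfold clamp, Rmax, Rmin, Rabs; repeat destruct Rle_dec; repeat destruct Rcase_abs; lra.
Qed.

(* [h] is prolonged past its two sides [x = lo], [x = hi] with slope 1 in [x], until it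
   acquires the signs required by [poincare_miranda_approx]. *)
Lemma poincare_miranda_complementarity (g h : R -> R -> R) (lo hi y0 y1 H e : R) :
  lo < hi -> y0 < y1 -> unif_cont2 lo hi y0 y1 g -> unif_cont2 lo hi y0 y1 h ->
  (forall x, lo <= x <= hi -> 0 < g x y0) -> (forall x, lo <= x <= hi -> g x y1 < 0) ->
  (forall x y, lo <= x <= hi -> y0 <= y <= y1 -> Rabs (h x y) <= H) -> 0 < e ->
  exists x y, lo <= x <= hi /\ y0 <= y <= y1 /\ Rabs (g x y) <= e /\
    (Rabs (h x y) <= e \/ (x = lo /\ - e <= h x y) \/ (x = hi /\ h x y <= e)).
Proof.
  intros Hlh Hy Ug Uh Hg0 Hg1 HH He.
  assert (C : forall x, lo <= clamp lo hi x <= hi) by (intros; apply clamp_in; lra).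
  assert (H0 : 0 <= H).
  { eapply Rle_trans; [apply Rabs_pos|apply (HH lo y0); lra]. }
  (* As [H] bounds [h], prolonging by [H + 1] on each side pushes the added linear term past [h] and
     leaves a margin of 1. *)
  destruct (poincare_miranda_approx
    (fun x y => g (clamp lo hi x) y)
    (fun x y => h (clamp lo hi x) y + (x - clamp lo hi x))
    (lo - H - 1) (hi + H + 1) y0 y1 e) as [x [y [Hx [Hy' [G1 G2]]]]]; try lra.
  - intros e' He'. destruct (Ug e' He') as [d [Hd K]]. exists d; split; [exact Hd|].
    intros x y x' y' _ Yy _ Yy' Hdx Hdy. apply K; auto.
    eapply Rle_trans; [apply clamp_lip|exact Hdx].
  - intros e' He'. destruct (Uh (e' / 2) ltac:(lra)) as [d [Hd K]].
    exists (Rmin d (e' / 2)); split; [apply Rmin_pos; lra|].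
    pose proof (Rmin_l d (e' / 2)). pose proof (Rmin_r d (e' / 2)).
    intros x y x' y' _ Yy _ Yy' Hdx Hdy.
    pose proof (sub_clamp_lip lo hi x x').
    assert (Rabs (h (clamp lo hi x) y - h (clamp lo hi x') y') <= e' / 2).
    { apply K; auto; [|lra]. eapply Rle_trans; [apply clamp_lip|lra]. }
    replace (h (clamp lo hi x) y + (x - clamp lo hi x) - (h (clamp lo hi x') y' + (x' - clamp lo hi x')))
      with ((h (clamp lo hi x) y - h (clamp lo hi x') y') +
            ((x - clamp lo hi x) - (x' - clamp lo hi x'))) by ring.
    eapply Rle_trans; [apply Rabs_triang|]. lra.
  - intros x _. apply Hg0, C.
  - intros x _. apply Hg1, C.
  - intros y Yy.
    replace (clamp lo hi (lo - H - 1)) with lo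
      by (unfold clamp, Rmax, Rmin; repeat destruct Rle_dec; lra).
    pose proof (HH lo y ltac:(lra) Yy) as B. apply Rabs_le_between in B. lra.
  - intros y Yy.
    replace (clamp lo hi (hi + H + 1)) with hi
      by (unfold clamp, Rmax, Rmin; repeat destruct Rle_dec; lra).
    pose proof (HH hi y ltac:(lra) Yy) as B. apply Rabs_le_between in B. lra.
  - exists (clamp lo hi x), y.
    split; [apply C|]. split; [exact Hy'|]. split; [exact G1|].
    destruct (Rlt_dec x lo) as [L|L]; [|destruct (Rlt_dec hi x) as [L'|L']].
    (* For [x < lo] the linear term is negative, so smallness of the prolonged function forces
       [h lo y >= - e]. The other side is symmetric. *)
    + right; left. replace (clamp lo hi x) with lo in *
        by (unfold clamp, Rmax, Rmin; repeat destruct Rle_dec; lra).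
      apply Rabs_le_between in G2. lra.
    + right; right. replace (clamp lo hi x) with hi in *
        by (unfold clamp, Rmax, Rmin; repeat destruct Rle_dec; lra).
      apply Rabs_le_between in G2. lra.
    + left. rewrite (clamp_id lo hi x) in * by lra.
      rewrite Rminus_diag, Rplus_0_r in G2. exact G2.
Qed.

(** * Ultralimits *)

(** Limits along one free ultrafilter replace successive extractions of subsequences: every bounded
    sequence converges, so a single [U] serves the parameters and the values at all times, and
    [uf_or] selects a branch of a disjunction valid for almost all indices. *)
Record free_ultrafilter (U : (nat -> Prop) -> Prop) : Prop := {
  uf_mono : forall A B : nat -> Prop, (forall n, A n -> B n) -> U A -> U B;
  uf_and : forall A B : nat -> Prop, U A -> U B -> U (fun n => A n /\ B n);
  uf_dec : forall A : nat -> Prop, U A \/ U (fun n => ~ A n);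
  uf_ex : forall A : nat -> Prop, U A -> exists n, A n;
  uf_tail : forall N, U (fun n => (N <= n)%nat)
}.

(** An ultrafilter refining the filter of cofinite sets; the latter yields [uf_tail]. *)
Lemma free_ultrafilter_exists : exists U, free_ultrafilter U.
Proof.
  destruct (@filter.ultraFilterLemma nat
    (fun A => exists N, forall n, (N <= n)%nat -> A n)) as [U [HU Hsub]].
  - apply filter.Build_ProperFilter.
    + intros [N HN]. exact (HN N (le_n N)).
    + apply filter.Build_Filter.
      * exists 0%nat. intros n _. exact I.
      * intros A B [N HN] [N' HN']. exists (max N N'). intros n Hn. split.
        -- apply HN; lia.
        -- apply HN'; lia.
      * intros A B HAB [N HN]. exists N. intros n Hn. apply HAB, HN, Hn.
  - pose proof (@filter.ultra_proper _ _ HU) as HP.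
    pose proof (@filter.filter_filter _ _ HP) as HF.
    exists U. split.
    + intros A B HAB HA. exact (@filter.filterS _ _ HF A B HAB HA).
    + intros A B HA HB. exact (@filter.filterI _ _ HF A B HA HB).
    + intros A. exact (@filter.in_ultra_setVsetC _ _ A HU).
    + intros A HA. exact (@filter.filter_ex _ _ HP A HA).
    + intros N. apply Hsub. exists N. auto.
Qed.

Definition ultralim (U : (nat -> Prop) -> Prop) (x : nat -> R) (l : R) : Prop :=
  forall e, 0 < e -> U (fun n => Rabs (x n - l) <= e).

Lemma uf_all U (A : nat -> Prop) : free_ultrafilter U -> (forall n, A n) -> U A.
Proof. intros HU HA. apply (uf_mono U HU (fun n => (0 <= n)%nat)); [auto|apply uf_tail, HU]. Qed.

Lemma uf_or U (A B : nat -> Prop) :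
  free_ultrafilter U -> U (fun n => A n \/ B n) -> U A \/ U B.
Proof.
  intros HU H. destruct (uf_dec U HU A) as [HA|HA]; [now left|right].
  apply (uf_mono U HU (fun n => (A n \/ B n) /\ ~ A n)); [tauto|].
  now apply uf_and.
Qed.

(** The limit is the supremum of the [y] lying below [x n] for almost all [n]. *)
Lemma ultralim_exists U (x : nat -> R) (B : R) :
  free_ultrafilter U -> (forall n, Rabs (x n) <= B) -> exists l, ultralim U x l.
Proof.
  intros HU HB.
  destruct (completeness (fun y => U (fun n => y <= x n))) as [l [Hub Hlub]].
  - exists B. intros y Hy. destruct (uf_ex U HU _ Hy) as [n Hn].
    specialize (HB n). apply Rabs_le_between in HB. lra.
  - exists (- B). apply uf_all; [exact HU|]. intros n.
    specialize (HB n). apply Rabs_le_between in HB. lra.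
  - exists l. intros e He.
    assert (H1 : U (fun n => ~ l + e <= x n)).
    { destruct (uf_dec U HU (fun n => l + e <= x n)) as [H|H]; [|exact H].
      exfalso. specialize (Hub _ H). lra. }
    assert (H2 : U (fun n => l - e <= x n)).
    { destruct (uf_dec U HU (fun n => l - e <= x n)) as [H|H]; [exact H|].
      exfalso. assert (l <= l - e); [|lra]. apply Hlub. intros y Hy.
      destruct (uf_ex U HU _ (uf_and U HU _ _ H Hy)) as [n [Hn1 Hn2]]. lra. }
    apply (uf_mono U HU _ _) with (2 := uf_and U HU _ _ H1 H2).
    intros n [Hn1 Hn2]. apply Rabs_le. lra.
Qed.

Lemma ultralim_bounds U (x : nat -> R) (l lo hi : R) :
  free_ultrafilter U -> ultralim U x l -> (forall n, lo <= x n <= hi) -> lo <= l <= hi.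
Proof.
  intros HU Hl Hx.
  split; apply Rnot_lt_le; intros Hlt.
  - destruct (uf_ex U HU _ (Hl ((lo - l) / 2) ltac:(lra))) as [n Hn].
    specialize (Hx n). apply Rabs_le_between in Hn. lra.
  - destruct (uf_ex U HU _ (Hl ((l - hi) / 2) ltac:(lra))) as [n Hn].
    specialize (Hx n). apply Rabs_le_between in Hn. lra.
Qed.

Lemma ultralim_inv_nat U : free_ultrafilter U -> ultralim U (fun n => / (INR n + 1)) 0.
Proof.
  intros HU e He. destruct (archimed_cor1 e He) as [N [HN HN0]].
  apply (uf_mono U HU (fun n => (N <= n)%nat)); [|apply uf_tail, HU].
  intros n Hn. apply le_INR in Hn. apply lt_0_INR in HN0.
  rewrite Rminus_0_r, Rabs_pos_eq by (apply Rlt_le, Rinv_0_lt_compat; lra).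
  apply Rlt_le, Rle_lt_trans with (/ INR N); [|exact HN].
  apply Rinv_le_contravar; lra.
Qed.

(* Finite net argument. *)
Lemma ultralim_uniform U (u : nat -> R -> R) (v : R -> R) (K T : R) :
  free_ultrafilter U -> 0 <= T -> 0 <= K ->
  (forall n s t, 0 <= s <= T -> 0 <= t <= T -> Rabs (u n s - u n t) <= K * Rabs (s - t)) ->
  (forall s t, 0 <= s <= T -> 0 <= t <= T -> Rabs (v s - v t) <= K * Rabs (s - t)) ->
  (forall t, 0 <= t <= T -> ultralim U (fun n => u n t) (v t)) ->
  forall e, 0 < e -> U (fun n => forall t, 0 <= t <= T -> Rabs (u n t - v t) <= e).
Proof.
  intros HU HT HK Lu Lv Hlim e He.
  set (h := e / (3 * (K + 1))).
  assert (Hh : 0 < h) by (apply Rdiv_lt_0_compat; lra).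
  assert (HKh : K * h <= e / 3).
  { assert ((K + 1) * h = e / 3) by (unfold h; field; lra). nra. }
  assert (Hnet : forall k : nat,
    U (fun n => forall t, 0 <= t <= T -> t <= INR k * h -> Rabs (u n t - v t) <= e)).
  { assert (Hseg : forall a, 0 <= a <= T ->
      U (fun n => forall t, 0 <= t <= T -> Rabs (t - a) <= h -> Rabs (u n t - v t) <= e)).
    { intros a Ha. apply (uf_mono U HU _ _) with (2 := Hlim a Ha (e / 3) ltac:(lra)).
      intros n Hn t Ht Hta.
      pose proof (Lu n t a Ht Ha) as L1. pose proof (Lv t a Ht Ha) as L2.
      assert (K * Rabs (t - a) <= e / 3) by (apply Rle_trans with (K * h); [nra|lra]).
      replace (u n t - v t) with ((u n t - u n a) + (u n a - v a) - (v t - v a)) by ring.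
      apply Rabs_le_between in L1, L2, Hn. apply Rabs_le. lra. }
    induction k as [|k IH].
    - apply (uf_mono U HU _ _) with (2 := Hseg 0 ltac:(lra)).
      intros n Hn t Ht Htk. simpl in Htk. apply Hn; [exact Ht|].
      rewrite Rabs_pos_eq; lra.
    - destruct (Rle_dec (INR k * h) T) as [Hk|Hk].
      + pose proof (pos_INR k).
        apply (uf_mono U HU _ _) with (2 := uf_and U HU _ _ IH (Hseg (INR k * h) ltac:(split; nra))).
        intros n [H1 H2] t Ht Htk. rewrite S_INR in Htk.
        destruct (Rle_dec t (INR k * h)); [now apply H1|].
        apply H2; [exact Ht|]. rewrite Rabs_pos_eq; lra.
      + apply (uf_mono U HU _ _) with (2 := IH).
        intros n H1 t Ht _. apply H1; lra. }
  destruct (archimed_cor1 (h / (T + 1))) as [N [HN HN0]]; [apply Rdiv_lt_0_compat; lra|].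
  apply (uf_mono U HU _ _) with (2 := Hnet N).
  intros n Hn t Ht. apply Hn; [exact Ht|].
  apply lt_0_INR in HN0.
  apply Rlt_div_r in HN; [|lra].
  apply (Rmult_lt_compat_r (INR N)) in HN; [|lra].
  replace (/ INR N * (T + 1) * INR N) with (T + 1) in HN by (field; lra). lra.
Qed.

(** * Trajectories with prescribed maximum *)

(** Continuity on the whole line spares side conditions on integrals and derivatives; data given on
    an interval take this form after composition with [clamp]. *)
Definition cts (f : R -> R) : Prop := forall x, continuous f x.

Lemma cts_ex_RInt f a b : cts f -> ex_RInt f a b.
Proof. intros H. apply (ex_RInt_continuous f). intros z _. apply H. Qed.

Lemma RInt_Chasles_R (f : R -> R) a b c :
  cts f -> RInt f a c = RInt f a b + RInt f b c.
Proof.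
  intros H. symmetry. apply (RInt_Chasles f a b c); now apply cts_ex_RInt.
Qed.

Lemma RInt_swap_R (f : R -> R) a b : cts f -> RInt f a b = - RInt f b a.
Proof.
  intros H. pose proof (RInt_Chasles_R f a b a H) as E.
  rewrite RInt_point in E. unfold zero in E; simpl in E. lra.
Qed.

Lemma RInt_ext_R (f g : R -> R) a b :
  (forall x, Rmin a b <= x <= Rmax a b -> f x = g x) -> RInt f a b = RInt g a b.
Proof. intros H. apply RInt_ext. intros x Hx. apply H. lra. Qed.

Lemma RInt_minus_R (f g : R -> R) a b :
  cts f -> cts g -> RInt (fun x => f x - g x) a b = RInt f a b - RInt g a b.
Proof.
  intros Hf Hg. apply (RInt_minus f g a b); now apply cts_ex_RInt.
Qed.

Lemma RInt_plus_R (f g : R -> R) a b :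
  cts f -> cts g -> RInt (fun x => f x + g x) a b = RInt f a b + RInt g a b.
Proof.
  intros Hf Hg. apply (RInt_plus f g a b); now apply cts_ex_RInt.
Qed.

Lemma RInt_scal_R (f : R -> R) k a b :
  cts f -> RInt (fun x => k * f x) a b = k * RInt f a b.
Proof. intros Hf. apply (RInt_scal f a b k). now apply cts_ex_RInt. Qed.

Lemma RInt_abs_le (f : R -> R) a b M :
  cts f -> (forall t, Rmin a b <= t <= Rmax a b -> Rabs (f t) <= M) ->
  Rabs (RInt f a b) <= Rabs (b - a) * M.
Proof.
  intros Hf HM. destruct (Rle_dec a b) as [Hab|Hab].
  - rewrite (Rabs_pos_eq (b - a)) by lra. apply abs_RInt_le_const; [exact Hab|now apply cts_ex_RInt|].
    intros t Ht. apply HM. rewrite Rmin_left, Rmax_right; lra.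
  - rewrite RInt_swap_R, Rabs_Ropp, Rabs_minus_sym by exact Hf.
    rewrite (Rabs_pos_eq (a - b)) by lra.
    apply abs_RInt_le_const; [lra|now apply cts_ex_RInt|].
    intros t Ht. apply HM. rewrite Rmin_right, Rmax_left; lra.
Qed.

Lemma RInt_pos (f : R -> R) a b :
  cts f -> a <= b -> (forall t, a <= t <= b -> 0 <= f t) -> 0 <= RInt f a b.
Proof.
  intros Hf Hab H. apply RInt_ge_0; [exact Hab|now apply cts_ex_RInt|].
  intros x Hx; apply H; lra.
Qed.

Lemma RInt_le_cts (f g : R -> R) a b :
  cts f -> cts g -> a <= b -> (forall t, a <= t <= b -> f t <= g t) -> RInt f a b <= RInt g a b.
Proof.
  intros Hf Hg Hab H. apply RInt_le; try (now apply cts_ex_RInt); [exact Hab|].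
  intros x Hx; apply H; lra.
Qed.

Lemma cts_ext f g : (forall x, f x = g x) -> cts f -> cts g.
Proof. intros E H x. now apply (continuous_ext f g). Qed.

Lemma cts_const c : cts (fun _ => c).
Proof. intros x. apply continuous_const. Qed.

Lemma cts_id : cts (fun x => x).
Proof. intros x. apply continuous_id. Qed.

Lemma cts_plus f g : cts f -> cts g -> cts (fun x => f x + g x).
Proof. intros Hf Hg x. apply (continuous_plus f g); [apply Hf|apply Hg]. Qed.

Lemma cts_minus f g : cts f -> cts g -> cts (fun x => f x - g x).
Proof. intros Hf Hg x. apply (continuous_minus f g); [apply Hf|apply Hg]. Qed.

Lemma cts_mult f g : cts f -> cts g -> cts (fun x => f x * g x).
Proof. intros Hf Hg x. apply (continuous_mult f g); [apply Hf|apply Hg]. Qed.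

Lemma cts_comp f g : cts f -> cts g -> cts (fun x => f (g x)).
Proof. intros Hf Hg x. apply (continuous_comp g f); [apply Hg|apply Hf]. Qed.

Lemma cts_lip (f : R -> R) K :
  (forall x y, Rabs (f x - f y) <= K * Rabs (x - y)) -> cts f.
Proof.
  intros H x. assert (HK : 0 <= K).
  { specialize (H 1 0). rewrite Rminus_0_r, Rabs_R1 in H. pose proof (Rabs_pos (f 1 - f 0)). lra. }
  apply continuity_pt_filterlim. intros e He.
  exists (e / (K + 1)). split; [apply Rdiv_lt_0_compat; lra|].
  intros y [_ Hy]. simpl in *. unfold R_dist in *.
  apply Rle_lt_trans with (1 := H y x).
  apply Rle_lt_trans with ((K + 1) * Rabs (y - x)); [pose proof (Rabs_pos (y - x)); nra|].
  rewrite Rmult_comm. apply Rlt_div_r; lra.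
Qed.

Lemma cts_clamp lo hi : cts (clamp lo hi).
Proof. apply (cts_lip _ 1). intros x y. rewrite Rmult_1_l. apply clamp_lip. Qed.

Lemma cts_clamp_comp (lo hi : R) (f : R -> R) (D : R -> Prop) :
  lo <= hi -> (forall x, lo <= x <= hi -> D x) -> continuous_on D f ->
  cts (fun x => f (clamp lo hi x)).
Proof.
  intros Hlh HD Hf x.
  eapply filterlim_comp; [|apply Hf, HD, clamp_in, Hlh].
  intros P HP. unfold within in HP.
  pose proof (cts_clamp lo hi x _ HP) as H. unfold filtermap in *.
  eapply filter_imp; [|exact H]. intros y Hy. apply Hy, HD, clamp_in, Hlh.
Qed.

Lemma cts_clamp_unif (lo hi : R) (f : R -> R) :
  lo <= hi -> cts f -> forall e, 0 < e -> exists d, 0 < d /\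
    forall x y, Rabs (x - y) <= d -> Rabs (f (clamp lo hi x) - f (clamp lo hi y)) <= e.
Proof.
  intros Hlh Hf e He.
  destruct (Heine f (fun x => lo <= x <= hi) (compact_P3 lo hi)) with (eps := mkposreal e He)
    as [[d Hd] Hu]; simpl in *.
  - intros x _. apply continuity_pt_filterlim, Hf.
  - exists (d / 2). split; [lra|]. intros x y Hxy.
    apply Rlt_le, Hu; try (now apply clamp_in).
    pose proof (clamp_lip lo hi x y). lra.
Qed.

(* [u'' = - y], maximal value [m] on [0, T]: for [0 <= tau <= T] the maximum is attained at [tau]
   with zero slope; for [tau < 0] it is attained at [0] with slope [tau], and for [tau > T] it is
   attained at [T] with slope [tau - T]. *)
Definition shoot (T m tau : R) (y : R -> R) (t : R) : R :=
  let c := clamp 0 T tau in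
  m + (tau - c) * (t - c) - RInt (fun s => (t - s) * y s) c t.

Lemma cts_kernel y t : cts y -> cts (fun s => (t - s) * y s).
Proof.
  intros Hy. apply cts_mult; [|exact Hy]. apply cts_minus; [apply cts_const|apply cts_id].
Qed.

Lemma between_in (a b lo hi t : R) :
  lo <= a <= hi -> lo <= b <= hi -> Rmin a b <= t <= Rmax a b -> lo <= t <= hi.
Proof. unfold Rmin, Rmax; destruct (Rle_dec a b); lra. Qed.

Lemma dist_in T a b : 0 <= a <= T -> 0 <= b <= T -> Rabs (a - b) <= T.
Proof. intros; apply Rabs_le; lra. Qed.

Lemma shoot_lip_t (T L B m tau : R) (y : R -> R) (s t : R) :
  0 < T -> 0 <= L -> - L <= tau <= T + L -> cts y -> (forall x, 0 <= y x <= B) ->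
  0 <= s <= T -> 0 <= t <= T ->
  Rabs (shoot T m tau y s - shoot T m tau y t) <= (L + 2 * (T * B)) * Rabs (s - t).
Proof.
  intros HT HL Htau Hy HB Hs Ht. unfold shoot.
  set (c := clamp 0 T tau).
  assert (Hc : 0 <= c <= T) by (apply clamp_in; lra).
  assert (Hw : Rabs (tau - c) <= L).
  { unfold c, clamp, Rmax, Rmin; repeat destruct Rle_dec; apply Rabs_le; lra. }
  assert (HB0 : 0 <= B) by (specialize (HB 0); lra).
  rewrite (RInt_Chasles_R (fun x => (s - x) * y x) c t s) by now apply cts_kernel.
  assert (E : RInt (fun x => (s - x) * y x) c t =
    RInt (fun x => (t - x) * y x) c t + (s - t) * RInt y c t).
  { rewrite <- RInt_scal_R by exact Hy.
    rewrite <- RInt_plus_R; [|now apply cts_kernel|apply cts_mult; [apply cts_const|exact Hy]].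
    apply RInt_ext_R. intros x _. ring. }
  rewrite E.
  assert (B1 : Rabs (RInt y c t) <= T * B).
  { eapply Rle_trans; [apply (RInt_abs_le y c t B Hy)|].
    - intros x _. rewrite Rabs_pos_eq; apply HB.
    - apply Rmult_le_compat_r; [exact HB0|now apply dist_in]. }
  assert (B2 : Rabs (RInt (fun x => (s - x) * y x) t s) <= Rabs (s - t) * (T * B)).
  { apply RInt_abs_le; [now apply cts_kernel|].
    intros x Hx. rewrite Rabs_mult. rewrite (Rabs_pos_eq (y x)) by apply HB.
    apply Rmult_le_compat; try apply Rabs_pos; try apply HB.
    apply dist_in; [exact Hs|]. apply (between_in t s); assumption. }
  match goal with |- Rabs ?X <= _ => replace X with
    ((tau - c) * (s - t) - (s - t) * RInt y c t - RInt (fun x => (s - x) * y x) t s) by ring end.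
  eapply Rle_trans; [apply Rabs_triang|]. rewrite Rabs_Ropp.
  eapply Rle_trans; [apply Rplus_le_compat_r, Rabs_triang|].
  rewrite Rabs_Ropp, !Rabs_mult.
  pose proof (Rabs_pos (s - t)). nra.
Qed.

Lemma shoot_close (T L B m tau m' tau' e : R) (y y' : R -> R) (t : R) :
  0 < T -> 0 <= L -> - L <= tau' <= T + L -> cts y -> cts y' -> (forall x, 0 <= y' x <= B) ->
  (forall x, 0 <= x <= T -> Rabs (y x - y' x) <= e) -> 0 <= t <= T ->
  Rabs (shoot T m tau y t - shoot T m' tau' y' t) <=
    Rabs (m - m') + (T + L + T * B) * Rabs (tau - tau') + T * T * e.
Proof.
  intros HT HL Htau Hy Hy' HB He Ht. unfold shoot.
  set (c := clamp 0 T tau). set (c' := clamp 0 T tau').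
  assert (Hc : 0 <= c <= T) by (apply clamp_in; lra).
  assert (Hc' : 0 <= c' <= T) by (apply clamp_in; lra).
  assert (Hw : Rabs (tau' - c') <= L).
  { unfold c', clamp, Rmax, Rmin; repeat destruct Rle_dec; apply Rabs_le; lra. }
  assert (HB0 : 0 <= B) by (specialize (HB 0); lra).
  assert (He0 : 0 <= e) by (eapply Rle_trans; [apply Rabs_pos|apply (He 0); lra]).
  pose proof (clamp_lip 0 T tau tau') as D1. fold c c' in D1.
  pose proof (sub_clamp_lip 0 T tau tau') as D2. fold c c' in D2.
  rewrite (RInt_Chasles_R (fun x => (t - x) * y' x) c' c t) by now apply cts_kernel.
  assert (B1 : Rabs (RInt (fun x => (t - x) * y x) c t - RInt (fun x => (t - x) * y' x) c t)
     <= T * (T * e)).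
  { rewrite <- RInt_minus_R by now apply cts_kernel.
    eapply Rle_trans; [apply (RInt_abs_le _ c t (T * e))|].
    - apply cts_minus; now apply cts_kernel.
    - intros x Hx. replace ((t - x) * y x - (t - x) * y' x) with ((t - x) * (y x - y' x)) by ring.
      rewrite Rabs_mult. assert (0 <= x <= T) by (apply (between_in c t); assumption).
      apply Rmult_le_compat; try apply Rabs_pos; [now apply dist_in|now apply He].
    - apply Rmult_le_compat_r; [nra|now apply dist_in]. }
  assert (B2 : Rabs (RInt (fun x => (t - x) * y' x) c' c) <= Rabs (c - c') * (T * B)).
  { apply RInt_abs_le; [now apply cts_kernel|].
    intros x Hx. rewrite Rabs_mult. rewrite (Rabs_pos_eq (y' x)) by apply HB.
    apply Rmult_le_compat; try apply Rabs_pos; try apply HB.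
    apply dist_in; [exact Ht|]. apply (between_in c' c); assumption. }
  (* The factor of [Rabs (tau - tau')] collects three effects: [T] from the change of slope at the
     peak, [L] from the displacement of the peak in the affine term, [T * B] from the displacement
     of the lower limit of the integral. *)
  match goal with |- Rabs ?X <= _ => replace X with
    ((m - m') + ((tau - c) - (tau' - c')) * (t - c) + (tau' - c') * - (c - c')
     + - (RInt (fun x => (t - x) * y x) c t - RInt (fun x => (t - x) * y' x) c t)
     + RInt (fun x => (t - x) * y' x) c' c) by ring end.
  assert (B3 : Rabs (((tau - c) - (tau' - c')) * (t - c)) <= T * Rabs (tau - tau')).
  { rewrite Rabs_mult. rewrite (Rmult_comm T). apply Rmult_le_compat; try apply Rabs_pos; [exact D2|].
    now apply dist_in. }
  assert (B4 : Rabs ((tau' - c') * - (c - c')) <= L * Rabs (tau - tau')).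
  { rewrite Rabs_mult, Rabs_Ropp. apply Rmult_le_compat; try apply Rabs_pos; assumption. }
  assert (B5 : Rabs (c - c') * (T * B) <= T * B * Rabs (tau - tau')) by (assert (0 <= T * B) by nra; nra).
  pose proof (Rle_abs (m - m')). pose proof (Rabs_maj2 (m - m')).
  apply Rabs_le_between in B1, B2, B3, B4. apply Rabs_le. lra.
Qed.

(** * The delayed equation *)

Lemma is_derive_RInt_cts (y : R -> R) c t : cts y -> is_derive (fun t => RInt y c t) t (y t).
Proof.
  intros Hy. apply (is_derive_RInt y (fun t => RInt y c t) c t); [|apply Hy].
  apply filter_forall. intros b. apply (RInt_correct y). now apply cts_ex_RInt.
Qed.

Lemma is_derive_shoot (T m tau t : R) (y : R -> R) :
  cts y -> is_derive (shoot T m tau y) t (tau - clamp 0 T tau - RInt y (clamp 0 T tau) t).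
Proof.
  intros Hy. unfold shoot. set (c := clamp 0 T tau).
  (* Expanding the kernel takes [t] out of the integrand, so that the fundamental theorem of
     calculus applies to each integral. *)
  apply is_derive_ext with
    (fun t => m + (tau - c) * (t - c) - (t * RInt y c t - RInt (fun s => s * y s) c t)).
  - intros x. f_equal. rewrite <- RInt_scal_R by exact Hy.
    rewrite <- RInt_minus_R;
      [|now apply cts_mult; [apply cts_const|]|now apply cts_mult; [apply cts_id|]].
    apply RInt_ext_R. intros s _. ring.
  - pose proof (is_derive_RInt_cts y c t Hy) as D1.
    pose proof (is_derive_RInt_cts (fun s => s * y s) c t
      ltac:(now apply cts_mult; [apply cts_id|])) as D2.
    assert (G : forall (Y Z : R -> R) y' z', is_derive Y t y' -> is_derive Z t z' ->
      is_derive (fun t => m + (tau - c) * (t - c) - (t * Y t - Z t)) t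
        (tau - c - (Y t + t * y' - z'))).
    { intros Y Z y' z' HY HZ. auto_derive.
      - repeat split; [exists y'; exact HY|exists z'; exact HZ].
      - change (Derive (fun x => Y x) t) with (Derive Y t).
        change (Derive (fun x => Z x) t) with (Derive Z t).
        rewrite (is_derive_unique _ _ _ HY), (is_derive_unique _ _ _ HZ). ring. }
    replace (tau - c - RInt y c t) with (tau - c - (RInt y c t + t * y t - t * y t)) by ring.
    exact (G _ _ _ _ D1 D2).
Qed.

Lemma cts_shoot T m tau y : cts y -> cts (shoot T m tau y).
Proof.
  intros Hy t. apply (ex_derive_continuous (shoot T m tau y)).
  eexists. now apply is_derive_shoot.
Qed.

(** Moves [s] towards [c] by the length [d], stopping at [c]. *)
Definition shift (c d s : R) : R := s - clamp (- d) d (s - c).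

Lemma shift_between c d s : 0 <= d -> Rmin c s <= shift c d s <= Rmax c s.
Proof. intros; unfold shift, clamp, Rmin, Rmax; repeat destruct Rle_dec; lra. Qed.

Lemma shift_near c d s : 0 <= d -> Rabs (shift c d s - s) <= d.
Proof.
  intros; unfold shift, clamp, Rmin, Rmax; repeat destruct Rle_dec; apply Rabs_le; lra.
Qed.

Lemma shift_center c d s : 0 <= d -> Rabs (shift c d s - c) <= Rmax (Rabs (s - c) - d) 0.
Proof.
  intros; unfold shift, clamp, Rmin, Rmax, Rabs; repeat destruct Rle_dec;
    repeat destruct Rcase_abs; lra.
Qed.

Lemma shift_lip_center c c' d s : Rabs (shift c d s - shift c' d s) <= Rabs (c - c').
Proof.
  unfold shift.
  replace (s - clamp (- d) d (s - c) - (s - clamp (- d) d (s - c')))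
    with (clamp (- d) d (s - c') - clamp (- d) d (s - c)) by ring.
  eapply Rle_trans; [apply clamp_lip|]. right. f_equal. ring.
Qed.

Lemma cts_shift c d : cts (shift c d).
Proof.
  apply cts_minus; [apply cts_id|].
  apply (cts_comp (clamp (- d) d) (fun s => s - c)); [apply cts_clamp|].
  apply cts_minus; [apply cts_id|apply cts_const].
Qed.

(* The argument of [F] at time [s] is the value of the trajectory at a time closer to the peak by
   [d], so that on [[0, T]] the sequence is stationary after [T / d] steps; no uniqueness of the
   Cauchy problem is needed. *)
Fixpoint delayed (T d : R) (A F : R -> R) (m tau : R) (k : nat) : R -> R :=
  match k with
  | O => fun _ => 0
  | S k => fun s =>
      A s * F (shoot T m tau (delayed T d A F m tau k) (shift (clamp 0 T tau) d s))
  end.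

(** What is kept of [a] and [f] once both are composed with [clamp]: boundedness and uniform
    continuity on the whole line, whatever values a trajectory takes. *)
Record admissible (B Am : R) (A F : R -> R) : Prop := {
  adm_ctsA : cts A;
  adm_ctsF : cts F;
  adm_A : forall s, 0 <= A s <= Am;
  adm_AF : forall s x, 0 <= A s * F x <= B;
  adm_unif : forall e, 0 < e -> exists d, 0 < d /\
    forall x y, Rabs (x - y) <= d -> Rabs (F x - F y) <= e
}.

Lemma adm_B_nonneg B Am A F : admissible B Am A F -> 0 <= B.
Proof. intros HA. pose proof (adm_AF _ _ _ _ HA 0 0). lra. Qed.

Lemma cts_delayed T d B Am A F m tau k : admissible B Am A F -> cts (delayed T d A F m tau k).
Proof.
  intros HA. induction k as [|k IH]; simpl; [apply cts_const|].
  apply cts_mult; [apply (adm_ctsA _ _ _ _ HA)|].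
  apply (cts_comp F); [apply (adm_ctsF _ _ _ _ HA)|].
  apply (cts_comp (shoot _ _ _ _)); [now apply cts_shoot|apply cts_shift].
Qed.

Lemma delayed_bounds T d B Am A F m tau k s :
  admissible B Am A F -> 0 <= delayed T d A F m tau k s <= B.
Proof.
  intros HA. destruct k; simpl; [|apply (adm_AF _ _ _ _ HA)].
  split; [lra|eapply adm_B_nonneg, HA].
Qed.

(** Induction on the distance to the peak: the value at distance at most [(k + 1) * d] depends on
    the forcing between the peak and [s], which reads the trajectory at distance at most [k * d]. At
    the peak itself the value is [m] at every stage. *)
Lemma delayed_stationary T d A F m tau k s :
  0 <= d -> Rabs (s - clamp 0 T tau) <= INR k * d ->
  shoot T m tau (delayed T d A F m tau (S k)) s = shoot T m tau (delayed T d A F m tau k) s.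
Proof.
  intros Hd. revert s. induction k as [|k IH]; intros s Hs.
  - simpl INR in Hs. rewrite Rmult_0_l in Hs.
    assert (E : s = clamp 0 T tau).
    { apply Rabs_le_between in Hs. lra. }
    unfold shoot. rewrite E. now rewrite !RInt_point.
  - unfold shoot at 1 2. f_equal. apply RInt_ext_R. intros x Hx. f_equal.
    change (delayed T d A F m tau (S (S k)) x) with
      (A x * F (shoot T m tau (delayed T d A F m tau (S k)) (shift (clamp 0 T tau) d x))).
    change (delayed T d A F m tau (S k) x) with
      (A x * F (shoot T m tau (delayed T d A F m tau k) (shift (clamp 0 T tau) d x))).
    rewrite IH; [reflexivity|].
    eapply Rle_trans; [now apply shift_center|].
    rewrite S_INR in Hs. pose proof (pos_INR k).
    apply Rmax_lub; [|nra].
    assert (Rabs (x - clamp 0 T tau) <= Rabs (s - clamp 0 T tau)); [|lra].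
    revert Hx. unfold Rmin, Rmax, Rabs; destruct Rle_dec; repeat destruct Rcase_abs; lra.
Qed.

Lemma small_factor C e : 0 <= C -> 0 < e -> exists d, 0 < d /\ forall x, 0 <= x <= d -> C * x <= e.
Proof.
  intros HC He. exists (e / (C + 1)). split; [apply Rdiv_lt_0_compat; lra|].
  intros x Hx. assert ((C + 1) * (e / (C + 1)) = e) by (field; lra). nra.
Qed.

(** The modulus [r] depends on the stage [k]. This is harmless because [k] is fixed together with
    the delay before the parameters vary. *)
Lemma delayed_unif T L d B Am A F k :
  0 < T -> 0 <= L -> 0 <= d -> admissible B Am A F ->
  forall e, 0 < e -> exists r, 0 < r /\ forall m tau m' tau',
    - L <= tau <= T + L -> - L <= tau' <= T + L -> Rabs (m - m') <= r -> Rabs (tau - tau') <= r ->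
    forall s, 0 <= s <= T ->
      Rabs (delayed T d A F m tau k s - delayed T d A F m' tau' k s) <= e.
Proof.
  intros HT HL Hd HA. induction k as [|k IH]; intros e He.
  { exists 1. split; [lra|]. intros. simpl. rewrite Rminus_diag, Rabs_R0. lra. }
  pose proof (adm_B_nonneg _ _ _ _ HA) as HB.
  assert (HAm : 0 <= Am) by (pose proof (adm_A _ _ _ _ HA 0); lra).
  destruct (small_factor Am e HAm He) as [eF [HeF KeF]].
  destruct (adm_unif _ _ _ _ HA eF HeF) as [q [Hq Kq]].
  assert (HTT : 0 <= T * T) by nra.
  assert (HTB : 0 <= T * B) by nra.
  (* The tolerance [q] for the argument of [F] is shared equally between the changes of [m], of
     [tau], of the previous forcing, and of the shifted time. *)
  destruct (small_factor (T * T) (q / 4) HTT ltac:(lra)) as [e1 [He1 Ke1]].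
  destruct (small_factor (T + L + T * B) (q / 4) ltac:(lra) ltac:(lra)) as [r1 [Hr1 Kr1]].
  destruct (small_factor (L + 2 * (T * B)) (q / 4) ltac:(lra) ltac:(lra)) as [r2 [Hr2 Kr2]].
  destruct (IH e1 He1) as [r3 [Hr3 Kr3]].
  set (r := Rmin (Rmin r1 r2) (Rmin r3 (q / 4))).
  assert (Hr : r <= r1 /\ r <= r2 /\ r <= r3 /\ r <= q / 4).
  { unfold r. pose proof (Rmin_l (Rmin r1 r2) (Rmin r3 (q / 4))).
    pose proof (Rmin_r (Rmin r1 r2) (Rmin r3 (q / 4))).
    pose proof (Rmin_l r1 r2). pose proof (Rmin_r r1 r2).
    pose proof (Rmin_l r3 (q / 4)). pose proof (Rmin_r r3 (q / 4)). lra. }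
  exists r. split; [unfold r; repeat apply Rmin_pos; lra|].
  intros m tau m' tau' Ht Ht' Hm Htt s Hs. simpl.
  set (c := clamp 0 T tau). set (c' := clamp 0 T tau').
  assert (Hc : 0 <= c <= T) by (apply clamp_in; lra).
  assert (Hc' : 0 <= c' <= T) by (apply clamp_in; lra).
  set (Y := delayed T d A F m tau k). set (Y' := delayed T d A F m' tau' k).
  assert (CY : cts Y) by (eapply cts_delayed, HA).
  assert (CY' : cts Y') by (eapply cts_delayed, HA).
  rewrite <- Rmult_minus_distr_l, Rabs_mult, (Rabs_pos_eq (A s)) by apply (adm_A _ _ _ _ HA).
  assert (HF : Rabs (F (shoot T m tau Y (shift c d s)) - F (shoot T m' tau' Y' (shift c' d s))) <= eF).
  { apply Kq.
    assert (S1 : 0 <= shift c d s <= T) by (apply (between_in c s); auto; now apply shift_between).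
    assert (S2 : 0 <= shift c' d s <= T) by (apply (between_in c' s); auto; now apply shift_between).
    pose proof (shoot_close T L B m tau m' tau' e1 Y Y' (shift c d s) HT HL Ht' CY CY'
      (fun x => delayed_bounds T d B Am A F m' tau' k x HA)
      (Kr3 m tau m' tau' Ht Ht' ltac:(lra) ltac:(lra)) S1) as H1.
    pose proof (shoot_lip_t T L B m' tau' Y' (shift c d s) (shift c' d s) HT HL Ht' CY'
      (fun x => delayed_bounds T d B Am A F m' tau' k x HA) S1 S2) as H2.
    pose proof (shift_lip_center c c' d s) as H3.
    pose proof (clamp_lip 0 T tau tau') as H4. fold c c' in H4.
    pose proof (Rabs_pos (tau - tau')).
    pose proof (Rabs_pos (shift c d s - shift c' d s)).
    pose proof (Kr1 (Rabs (tau - tau')) ltac:(lra)).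
    pose proof (Kr2 (Rabs (shift c d s - shift c' d s)) ltac:(lra)).
    pose proof (Ke1 e1 ltac:(lra)).
    apply Rabs_le_between in H1, H2. apply Rabs_le. lra. }
  apply Rle_trans with (Am * eF).
  - apply Rmult_le_compat; try apply Rabs_pos; try apply (adm_A _ _ _ _ HA). exact HF.
  - apply KeF. lra.
Qed.

(** Regularity shared by the two boundary defects; it gives both their continuity in the parameters
    and their convergence under uniform limits. *)
Definition sup_lipschitz (T C : R) (N : (R -> R) -> R) : Prop :=
  forall u v e, cts u -> cts v -> (forall t, 0 <= t <= T -> Rabs (u t - v t) <= e) ->
    Rabs (N u - N v) <= C * e.

Lemma functional_unif_cont T L d B Am A F k C N lo hi :
  0 < T -> 0 <= L -> 0 <= d -> admissible B Am A F -> 0 <= C -> sup_lipschitz T C N ->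
  unif_cont2 lo hi (- L) (T + L) (fun m tau => N (shoot T m tau (delayed T d A F m tau k))).
Proof.
  intros HT HL Hd HA HC HN e He.
  pose proof (adm_B_nonneg _ _ _ _ HA) as HB.
  assert (HTT : 0 <= T * T) by nra.
  assert (HTB : 0 <= T * B) by nra.
  destruct (small_factor C e HC He) as [q [Hq Kq]].
  destruct (small_factor (T * T) (q / 3) HTT ltac:(lra)) as [e1 [He1 Ke1]].
  destruct (small_factor (T + L + T * B) (q / 3) ltac:(lra) ltac:(lra)) as [r1 [Hr1 Kr1]].
  destruct (delayed_unif T L d B Am A F k HT HL Hd HA e1 He1) as [r3 [Hr3 Kr3]].
  set (r := Rmin r1 (Rmin r3 (q / 3))).
  assert (Hr : r <= r1 /\ r <= r3 /\ r <= q / 3).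
  { unfold r. pose proof (Rmin_l r1 (Rmin r3 (q / 3))).
    pose proof (Rmin_r r1 (Rmin r3 (q / 3))).
    pose proof (Rmin_l r3 (q / 3)). pose proof (Rmin_r r3 (q / 3)). lra. }
  exists r. split; [unfold r; repeat apply Rmin_pos; lra|].
  intros m tau m' tau' _ Ht _ Ht' Hm Htt.
  apply Rle_trans with (C * q); [|apply Kq; lra].
  apply HN; try (apply cts_shoot; eapply cts_delayed, HA).
  intros t Hti.
  eapply Rle_trans.
  { apply (shoot_close T L B m tau m' tau' e1); auto.
    - eapply cts_delayed, HA.
    - eapply cts_delayed, HA.
    - intros x. eapply delayed_bounds, HA.
    - intros x Hx. apply Kr3; auto; lra. }
  pose proof (Rabs_pos (tau - tau')).
  pose proof (Kr1 (Rabs (tau - tau')) ltac:(lra)).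
  pose proof (Ke1 e1 ltac:(lra)). lra.
Qed.

(** Comparison with the zero function. It supplies the bound on [h] that fixes the length of the
    prolongation in [poincare_miranda_complementarity]. *)
Lemma functional_bound T L B C N y m tau :
  0 < T -> 0 <= L -> - L <= tau <= T + L -> sup_lipschitz T C N -> 0 <= C -> cts y ->
  (forall x, 0 <= y x <= B) ->
  Rabs (N (shoot T m tau y)) <= Rabs (N (fun _ => 0)) + C * (Rabs m + (L * T + T * (T * B))).
Proof.
  intros HT HL Ht HN HC Hy HB.
  pose proof (HN (shoot T m tau y) (fun _ => 0) (Rabs m + (L * T + T * (T * B)))
    ltac:(now apply cts_shoot) (cts_const 0)) as H.
  match type of H with ?X -> _ => assert (HX : X) end.
  { intros t Hti. rewrite Rminus_0_r. unfold shoot. set (c := clamp 0 T tau).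
    assert (Hc : 0 <= c <= T) by (apply clamp_in; lra).
    assert (Hw : Rabs (tau - c) <= L).
    { unfold c, clamp, Rmax, Rmin; repeat destruct Rle_dec; apply Rabs_le; lra. }
    assert (HB0 : 0 <= B) by (specialize (HB 0); lra).
    assert (B1 : Rabs ((tau - c) * (t - c)) <= L * T).
    { rewrite Rabs_mult. apply Rmult_le_compat; try apply Rabs_pos; [exact Hw|now apply dist_in]. }
    assert (B2 : Rabs (RInt (fun s => (t - s) * y s) c t) <= T * (T * B)).
    { eapply Rle_trans; [apply (RInt_abs_le _ c t (T * B)); [now apply cts_kernel|]|].
      - intros x Hx. rewrite Rabs_mult, (Rabs_pos_eq (y x)) by apply HB.
        apply Rmult_le_compat; try apply Rabs_pos; try apply HB.
        apply dist_in; [exact Hti|]. apply (between_in c t); assumption.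
      - apply Rmult_le_compat_r; [nra|now apply dist_in]. }
    pose proof (Rle_abs m). pose proof (Rabs_maj2 m).
    apply Rabs_le_between in B1, B2. apply Rabs_le. lra. }
  specialize (H HX).
  pose proof (Rabs_triang (N (shoot T m tau y) - N (fun _ => 0)) (N (fun _ => 0))) as H2.
  replace (N (shoot T m tau y) - N (fun _ => 0) + N (fun _ => 0)) with (N (shoot T m tau y)) in H2 by ring.
  lra.
Qed.

Lemma approximate_solution T L B Am A F Cg Ch g h lo hi e :
  0 < T -> 0 <= L -> admissible B Am A F -> 0 <= Cg -> 0 <= Ch ->
  sup_lipschitz T Cg g -> sup_lipschitz T Ch h -> 0 < lo < hi ->
  (forall m y, lo <= m <= hi -> cts y -> (forall x, 0 <= y x <= B) ->
     0 < g (shoot T m (- L) y) /\ g (shoot T m (T + L) y) < 0) ->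
  0 < e ->
  exists m tau y, lo <= m <= hi /\ - L <= tau <= T + L /\ cts y /\ (forall x, 0 <= y x <= B) /\
    (forall s, 0 <= s <= T -> exists s', 0 <= s' <= T /\ Rabs (s' - s) <= e /\
       y s = A s * F (shoot T m tau y s')) /\
    Rabs (g (shoot T m tau y)) <= e /\
    (Rabs (h (shoot T m tau y)) <= e \/
     (m = lo /\ - e <= h (shoot T m tau y)) \/ (m = hi /\ h (shoot T m tau y) <= e)).
Proof.
  intros HT HL HA HCg HCh Hg Hh Hlh Hsign He.
  (* The number of stages is chosen so that [k] delays of length [e] cover the interval. *)
  destruct (archimed_cor1 (e / T)) as [k [Hk Hk0]]; [apply Rdiv_lt_0_compat; lra|].
  assert (HkT : T <= INR k * e).
  { apply lt_0_INR in Hk0. apply Rlt_div_r in Hk; [|lra].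
    apply (Rmult_lt_compat_r (INR k)) in Hk; [|lra].
    replace (/ INR k * T * INR k) with T in Hk by (field; lra). lra. }
  set (Y := fun m tau => delayed T e A F m tau (S k)).
  assert (CY : forall m tau, cts (Y m tau)) by (intros; eapply cts_delayed, HA).
  assert (BY : forall m tau x, 0 <= Y m tau x <= B) by (intros; eapply delayed_bounds, HA).
  destruct (poincare_miranda_complementarity
    (fun m tau => g (shoot T m tau (Y m tau))) (fun m tau => h (shoot T m tau (Y m tau)))
    lo hi (- L) (T + L) (Rabs (h (fun _ => 0)) + Ch * (hi + (L * T + T * (T * B)))) e)
    as [m [tau [Hm [Ht [G1 G2]]]]]; try lra.
  - apply (functional_unif_cont T L e B Am A F (S k) Cg); auto; lra.
  - apply (functional_unif_cont T L e B Am A F (S k) Ch); auto; lra.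
  - intros m Hm. apply Hsign; auto.
  - intros m Hm. apply Hsign; auto.
  - intros m tau Hm Ht.
    eapply Rle_trans; [apply (functional_bound T L B Ch); auto|].
    rewrite (Rabs_pos_eq m) by lra. nra.
  - exists m, tau, (Y m tau). repeat (split; auto).
    intros s Hs. exists (shift (clamp 0 T tau) e s).
    assert (Hc : 0 <= clamp 0 T tau <= T) by (apply clamp_in; lra).
    assert (Hsh : 0 <= shift (clamp 0 T tau) e s <= T).
    { apply (between_in (clamp 0 T tau) s); auto. apply shift_between; lra. }
    split; [exact Hsh|]. split; [apply shift_near; lra|].
    (* By definition stage [S k] of the forcing reads the trajectory of stage [k]; stationarity
       identifies the latter with the trajectory of stage [S k], which closes the delayed
       equation. *)
    unfold Y. rewrite delayed_stationary; [reflexivity|lra|].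
    apply Rle_trans with T; [now apply dist_in|exact HkT].
Qed.

(** * Vanishing delay *)

Lemma le_all_eps (x y C : R) : 0 <= C -> (forall e, 0 < e -> x <= y + C * e) -> x <= y.
Proof.
  intros HC H. apply Rnot_lt_le. intros Hlt.
  destruct (small_factor C ((x - y) / 2) HC ltac:(lra)) as [d [Hd K]].
  specialize (H d Hd). specialize (K d ltac:(lra)). lra.
Qed.

(** Approximate trajectories share a Lipschitz constant, so their pointwise ultralimit is uniform.
    The forcings then converge too, and the limit trajectory generates its own forcing without
    delay. *)
Lemma exact_solution T L B Am A F Cg Ch g h lo hi :
  0 < T -> 0 <= L -> admissible B Am A F -> 0 <= Cg -> 0 <= Ch ->
  sup_lipschitz T Cg g -> sup_lipschitz T Ch h -> 0 < lo < hi ->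
  (forall m y, lo <= m <= hi -> cts y -> (forall x, 0 <= y x <= B) ->
     0 < g (shoot T m (- L) y) /\ g (shoot T m (T + L) y) < 0) ->
  exists m tau y, lo <= m <= hi /\ cts y /\ (forall x, 0 <= y x <= B) /\
    (forall s, 0 <= s <= T -> y s = A s * F (shoot T m tau y s)) /\
    g (shoot T m tau y) = 0 /\
    (h (shoot T m tau y) = 0 \/
     (m = lo /\ 0 <= h (shoot T m tau y)) \/ (m = hi /\ h (shoot T m tau y) <= 0)).
Proof.
  intros HT HL HA HCg HCh Hg Hh Hlh Hsign.
  pose proof (adm_B_nonneg _ _ _ _ HA) as HB.
  assert (HAm : 0 <= Am) by (pose proof (adm_A _ _ _ _ HA 0); lra).
  set (en := fun n : nat => / (INR n + 1)).
  assert (Hen : forall n, 0 < en n).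
  { intros n. apply Rinv_0_lt_compat. pose proof (pos_INR n). lra. }
  set (Sol := fun (n : nat) (z : R * R * (R -> R)) =>
    let '(m, tau, y) := z in
    lo <= m <= hi /\ - L <= tau <= T + L /\ cts y /\ (forall x, 0 <= y x <= B) /\
    (forall s, 0 <= s <= T -> exists s', 0 <= s' <= T /\ Rabs (s' - s) <= en n /\
       y s = A s * F (shoot T m tau y s')) /\
    Rabs (g (shoot T m tau y)) <= en n /\
    (Rabs (h (shoot T m tau y)) <= en n \/
     (m = lo /\ - en n <= h (shoot T m tau y)) \/ (m = hi /\ h (shoot T m tau y) <= en n))).
  destruct (functional_choice Sol) as [z Hz].
  { intros n.
    destruct (approximate_solution T L B Am A F Cg Ch g h lo hi (en n))
      as [m [tau [y Hy]]]; auto.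
    exists (m, tau, y). exact Hy. }
  set (mn := fun n => fst (fst (z n))). set (tn := fun n => snd (fst (z n))).
  set (yn := fun n => snd (z n)).
  assert (HS : forall n, Sol n (mn n, tn n, yn n)).
  { intros n. unfold mn, tn, yn. destruct (z n) as [[m tau] y] eqn:E. simpl.
    specialize (Hz n). now rewrite E in Hz. }
  clearbody mn tn yn. clear z Hz. unfold Sol in HS. clear Sol.
  set (un := fun n => shoot T (mn n) (tn n) (yn n)).
  set (K := L + 2 * (T * B)).
  assert (HTB : 0 <= T * B) by nra.
  assert (HK : 0 <= K) by (unfold K; lra).
  assert (Lu : forall n s t, 0 <= s <= T -> 0 <= t <= T ->
    Rabs (un n s - un n t) <= K * Rabs (s - t)).
  { intros n s t Hs Ht. apply shoot_lip_t; auto; apply HS. }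
  destruct free_ultrafilter_exists as [U HU].
  destruct (ultralim_exists U mn hi HU) as [m Hm].
  { intros n. destruct (HS n) as [H _]. apply Rabs_le. lra. }
  destruct (ultralim_exists U tn (T + L) HU) as [tau Htau].
  { intros n. destruct (HS n) as [_ [H _]]. apply Rabs_le. lra. }
  assert (Hm' : lo <= m <= hi) by (apply (ultralim_bounds U mn); auto; apply HS).
  assert (Htau' : - L <= tau <= T + L) by (apply (ultralim_bounds U tn); auto; apply HS).
  (* Clamping the time defines the limit [v] on the whole line and makes it globally Lipschitz. *)
  destruct (functional_choice (fun t l => ultralim U (fun n => un n (clamp 0 T t)) l))
    as [v Hv].
  { intros t. assert (Ht : 0 <= clamp 0 T t <= T) by (apply clamp_in; lra).
    apply (ultralim_exists U _ (hi + K * T) HU). intros n.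
    pose proof (Lu n (clamp 0 T t) (clamp 0 T (tn n)) Ht ltac:(apply clamp_in; lra)) as H.
    (* The value at the peak is [mn n <= hi], and the Lipschitz bound carries this to the other
       times. *)
    assert (E : un n (clamp 0 T (tn n)) = mn n).
    { unfold un, shoot. rewrite RInt_point. unfold zero; simpl. ring. }
    rewrite E in H. destruct (HS n) as [Hmn _].
    assert (K * Rabs (clamp 0 T t - clamp 0 T (tn n)) <= K * T).
    { apply Rmult_le_compat_l; [exact HK|]. apply dist_in; [exact Ht|apply clamp_in; lra]. }
    apply Rabs_le_between in H. apply Rabs_le. lra. }
  assert (Lv : forall s t, Rabs (v s - v t) <= K * Rabs (s - t)).
  { intros s t. apply (le_all_eps _ _ 2); [lra|]. intros e He.
    destruct (uf_ex U HU _ (uf_and U HU _ _ (Hv s e He) (Hv t e He))) as [n [H1 H2]].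
    pose proof (Lu n (clamp 0 T s) (clamp 0 T t) ltac:(apply clamp_in; lra)
      ltac:(apply clamp_in; lra)) as H3.
    assert (K * Rabs (clamp 0 T s - clamp 0 T t) <= K * Rabs (s - t))
      by (apply Rmult_le_compat_l; [exact HK|apply clamp_lip]).
    apply Rabs_le_between in H1, H2, H3. apply Rabs_le. lra. }
  assert (Cv : cts v) by (apply (cts_lip v K Lv)).
  assert (Hunif : forall e, 0 < e ->
    U (fun n => forall t, 0 <= t <= T -> Rabs (un n t - v t) <= e)).
  { apply (ultralim_uniform U un v K T HU); auto; [lra|].
    intros t Ht e He. pose proof (Hv t e He) as H. now rewrite (clamp_id 0 T t Ht) in H. }
  set (y0 := fun s => A s * F (v s)).
  assert (Cy0 : cts y0).
  { apply cts_mult; [apply (adm_ctsA _ _ _ _ HA)|].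
    apply (cts_comp F); [apply (adm_ctsF _ _ _ _ HA)|exact Cv]. }
  assert (By0 : forall x, 0 <= y0 x <= B) by (intros; apply (adm_AF _ _ _ _ HA)).
  set (w := shoot T m tau y0).
  assert (Cw : cts w) by now apply cts_shoot.
  assert (Cun : forall n, cts (un n)) by (intros n; apply cts_shoot, HS).
  (* [yn n] reads [un n] at times displaced by at most [en n]. Closeness of [un n] to [v], the
     Lipschitz bound on [v] and the uniform continuity of [F] make it close to [y0]; [shoot_close]
     transfers this to the trajectories. *)
  assert (Hw : forall e, 0 < e ->
    U (fun n => forall t, 0 <= t <= T -> Rabs (un n t - w t) <= e)).
  { intros e He.
    destruct (small_factor (T * T) (e / 3) ltac:(nra) ltac:(lra)) as [e1 [He1 Ke1]].
    destruct (small_factor (T + L + T * B) (e / 3) ltac:(lra) ltac:(lra)) as [r1 [Hr1 Kr1]].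
    destruct (small_factor Am e1 HAm He1) as [eF [HeF KeF]].
    destruct (adm_unif _ _ _ _ HA eF HeF) as [q [Hq Kq]].
    destruct (small_factor K (q / 2) HK ltac:(lra)) as [q1 [Hq1 Kq1]].
    pose proof (uf_and U HU _ _ (uf_and U HU _ _ (Hm (e / 3) ltac:(lra)) (Htau r1 Hr1))
      (uf_and U HU _ _ (Hunif (q / 2) ltac:(lra)) (ultralim_inv_nat U HU q1 Hq1))) as HUU.
    apply (uf_mono U HU _ _) with (2 := HUU).
    intros n [[N1 N2] [N3 N4]] t Ht.
    change (Rabs (en n - 0) <= q1) in N4. rewrite Rminus_0_r, Rabs_pos_eq in N4 by apply Rlt_le, Hen.
    destruct (HS n) as [_ [_ [Cyn [_ [Eyn _]]]]].
    eapply Rle_trans.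
    { apply (shoot_close T L B (mn n) (tn n) m tau e1 (yn n) y0 t); auto.
      intros s Hs. destruct (Eyn s Hs) as [s' [Hs' [Hss Es]]]. rewrite Es. unfold y0.
      rewrite <- Rmult_minus_distr_l, Rabs_mult, (Rabs_pos_eq (A s)) by apply (adm_A _ _ _ _ HA).
      apply Rle_trans with (Am * eF); [|apply KeF; lra].
      apply Rmult_le_compat; try apply Rabs_pos; try apply (adm_A _ _ _ _ HA).
      apply Kq. pose proof (N3 s' Hs') as N3'. unfold un in N3'.
      pose proof (Lv s' s) as L1.
      pose proof (Kq1 (Rabs (s' - s)) ltac:(pose proof (Rabs_pos (s' - s)); lra)).
      apply Rabs_le_between in N3', L1. apply Rabs_le. lra. }
    pose proof (Kr1 (Rabs (tn n - tau)) ltac:(pose proof (Rabs_pos (tn n - tau)); lra)).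
    pose proof (Ke1 e1 ltac:(lra)). lra. }
  (* [un n] tends uniformly to both [v] and [w], so [v] is the trajectory of the forcing that it
     defines. *)
  assert (Evw : forall t, 0 <= t <= T -> v t = w t).
  { intros t Ht. apply Rminus_diag_uniq.
    assert (H : Rabs (v t - w t) <= 0).
    { apply (le_all_eps _ _ 2); [lra|]. intros e He.
      destruct (uf_ex U HU _ (uf_and U HU _ _ (Hunif e He) (Hw e He))) as [n [H1 H2]].
      specialize (H1 t Ht). specialize (H2 t Ht).
      apply Rabs_le_between in H1, H2. apply Rabs_le. lra. }
    apply Rabs_le_between in H. lra. }
  exists m, tau, y0. fold w.
  split; [exact Hm'|]. split; [exact Cy0|]. split; [exact By0|].
  split. { intros s Hs. unfold y0 at 1. now rewrite Evw. }
  pose proof (ultralim_inv_nat U HU) as Hen0.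
  assert (Uen : forall e, 0 < e -> U (fun n => en n <= e)).
  { intros e He. apply (uf_mono U HU _ _) with (2 := Hen0 e He). intros n H.
    change (Rabs (en n - 0) <= e) in H. apply Rabs_le_between in H. lra. }
  assert (Lim : forall C N e, sup_lipschitz T C N -> 0 < e ->
    U (fun n => en n <= e /\ Rabs (N (un n) - N w) <= C * e)).
  { intros C N e HN He. apply (uf_mono U HU _ _) with (2 := uf_and U HU _ _ (Uen e He) (Hw e He)).
    intros n [H1 H2]. split; [exact H1|]. apply HN; auto. }
  split.
  - assert (H : Rabs (g w) <= 0).
    { apply (le_all_eps _ _ (1 + Cg)); [lra|]. intros e He.
      destruct (uf_ex U HU _ (Lim Cg g e Hg He)) as [n [H1 H2]].
      destruct (HS n) as [_ [_ [_ [_ [_ [H3 _]]]]]]. fold (un n) in H3.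
      apply Rabs_le_between in H2, H3. apply Rabs_le. lra. }
    apply Rabs_le_between in H. lra.
  (* One of the three alternatives holds for almost all indices, and that one passes to the
     limit. *)
  - assert (Hcase := uf_all U _ HU (fun n => proj2 (proj2 (proj2 (proj2 (proj2 (proj2 (HS n)))))))).
    apply uf_or in Hcase; [|exact HU].
    destruct Hcase as [Hc|Hcase]; [|apply uf_or in Hcase; [destruct Hcase as [Hc|Hc]|exact HU]].
    + left. assert (H : Rabs (h w) <= 0).
      { apply (le_all_eps _ _ (1 + Ch)); [lra|]. intros e He.
        destruct (uf_ex U HU _ (uf_and U HU _ _ Hc (Lim Ch h e Hh He))) as [n [H3 [H1 H2]]].
        fold (un n) in H3.
        apply Rabs_le_between in H2, H3. apply Rabs_le. lra. }
      apply Rabs_le_between in H. lra.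
    + right; left. split.
      * assert (H : Rabs (m - lo) <= 0).
        { apply (le_all_eps _ _ 1); [lra|]. intros e He.
          destruct (uf_ex U HU _ (uf_and U HU _ _ Hc (Hm e He))) as [n [[H3 _] H1]].
          rewrite H3 in H1. rewrite Rabs_minus_sym. lra. }
        apply Rabs_le_between in H. lra.
      * assert (- h w <= 0); [|lra].
        apply (le_all_eps _ _ (1 + Ch)); [lra|]. intros e He.
        destruct (uf_ex U HU _ (uf_and U HU _ _ Hc (Lim Ch h e Hh He))) as [n [[_ H3] [H1 H2]]].
        fold (un n) in H3. apply Rabs_le_between in H2. lra.
    + right; right. split.
      * assert (H : Rabs (m - hi) <= 0).
        { apply (le_all_eps _ _ 1); [lra|]. intros e He.
          destruct (uf_ex U HU _ (uf_and U HU _ _ Hc (Hm e He))) as [n [[H3 _] H1]].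
          rewrite H3 in H1. rewrite Rabs_minus_sym. lra. }
        apply Rabs_le_between in H. lra.
      * apply (le_all_eps _ _ (1 + Ch)); [lra|]. intros e He.
        destruct (uf_ex U HU _ (uf_and U HU _ _ Hc (Lim Ch h e Hh He))) as [n [[_ H3] [H1 H2]]].
        fold (un n) in H3. apply Rabs_le_between in H2. lra.
Qed.

(** * Signs of the boundary defects *)

Lemma RInt_affine (p q a b : R) :
  RInt (fun t => p + q * t) a b = p * (b - a) + q * (b ^ 2 - a ^ 2) / 2.
Proof.
  apply is_RInt_unique.
  replace (p * (b - a) + q * (b ^ 2 - a ^ 2) / 2) with
    (minus ((fun t => p * t + q * t ^ 2 / 2) b) ((fun t => p * t + q * t ^ 2 / 2) a))
    by (unfold minus, plus, opp; simpl; field).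
  apply (is_RInt_derive (fun t => p * t + q * t ^ 2 / 2)).
  - intros x _. auto_derive; [trivial|field].
  - intros x _. apply (cts_plus (fun _ => p) (fun t => q * t)); [apply cts_const|].
    apply (cts_mult (fun _ => q) (fun t => t)); [apply cts_const|apply cts_id].
Qed.

(** For [b < a] the kernel and the orientation of the integral change sign together. This is the
    source of all concavity estimates below. *)
Lemma kernel_nonneg (y : R -> R) a b :
  cts y -> (forall x, 0 <= y x) -> 0 <= RInt (fun s => (b - s) * y s) a b.
Proof.
  intros Hy H. destruct (Rle_dec a b) as [Hab|Hab].
  - apply RInt_pos; [now apply cts_kernel|exact Hab|].
    intros t Ht. apply Rmult_le_pos; [lra|apply H].
  - rewrite RInt_swap_R by now apply cts_kernel.
    assert (RInt (fun s => (b - s) * y s) b a <= RInt (fun _ => 0) b a).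
    { apply RInt_le_cts; [now apply cts_kernel|apply cts_const|lra|].
      intros t Ht. pose proof (H t). nra. }
    rewrite RInt_const in H0. unfold scal in H0; simpl in H0; unfold mult in H0; simpl in H0. lra.
Qed.

Definition slope (T tau : R) (y : R -> R) (t : R) : R :=
  tau - clamp 0 T tau - RInt y (clamp 0 T tau) t.

(** Taylor formula with integral remainder, moving the base point from the peak to an arbitrary [p];
    [slope] is the derivative computed in [is_derive_shoot]. *)
Lemma shoot_taylor T m tau y p t : cts y ->
  shoot T m tau y t =
    shoot T m tau y p + slope T tau y p * (t - p) - RInt (fun s => (t - s) * y s) p t.
Proof.
  intros Hy. unfold shoot, slope. set (c := clamp 0 T tau).
  rewrite (RInt_Chasles_R (fun x => (t - x) * y x) c p t) by now apply cts_kernel.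
  assert (E : RInt (fun x => (t - x) * y x) c p =
    RInt (fun x => (p - x) * y x) c p + (t - p) * RInt y c p).
  { rewrite <- RInt_scal_R by exact Hy.
    rewrite <- RInt_plus_R; [|now apply cts_kernel|apply cts_mult; [apply cts_const|exact Hy]].
    apply RInt_ext_R. intros x _. ring. }
  rewrite E. ring.
Qed.

(** A nonzero slope occurs only for a peak at an endpoint, where it makes the affine part decrease
    towards the inside of the interval. *)
Lemma shoot_le_peak T m tau y t :
  0 < T -> cts y -> (forall x, 0 <= y x) -> 0 <= t <= T -> shoot T m tau y t <= m.
Proof.
  intros HT Hy H Ht. unfold shoot. set (c := clamp 0 T tau).
  pose proof (kernel_nonneg y c t Hy H).
  assert ((tau - c) * (t - c) <= 0); [|lra].
  unfold c, clamp, Rmax, Rmin; repeat destruct Rle_dec; nra.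
Qed.

Lemma shoot_peak T m tau y : shoot T m tau y (clamp 0 T tau) = m.
Proof. unfold shoot. rewrite RInt_point. unfold zero; simpl. ring. Qed.

Lemma shoot_tangent T m tau y p t : cts y -> (forall x, 0 <= y x) ->
  shoot T m tau y t <= shoot T m tau y p + slope T tau y p * (t - p).
Proof.
  intros Hy H. rewrite (shoot_taylor T m tau y p t Hy).
  pose proof (kernel_nonneg y p t Hy H). lra.
Qed.

Lemma shoot_concave T m tau y a b c : cts y -> (forall x, 0 <= y x) -> a <= b <= c ->
  (c - b) * shoot T m tau y a + (b - a) * shoot T m tau y c <= (c - a) * shoot T m tau y b.
Proof.
  intros Hy H Habc.
  pose proof (shoot_tangent T m tau y b a Hy H).
  pose proof (shoot_tangent T m tau y b c Hy H). nra.
Qed.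

Definition left_defect (eta beta : R) (u : R -> R) : R := u 0 - beta * u eta.
Definition right_defect (T eta alpha : R) (u : R -> R) : R := u T - alpha * RInt u 0 eta.

Lemma left_defect_lipschitz T eta beta :
  0 < eta < T -> 0 <= beta -> sup_lipschitz T (1 + beta) (left_defect eta beta).
Proof.
  intros He Hb u v e _ _ H. unfold left_defect.
  pose proof (H 0 ltac:(lra)) as H0. pose proof (H eta ltac:(lra)) as H1.
  apply Rabs_le_between in H0, H1. apply Rabs_le. nra.
Qed.

Lemma right_defect_lipschitz T eta alpha :
  0 < eta < T -> 0 <= alpha -> sup_lipschitz T (1 + alpha * eta) (right_defect T eta alpha).
Proof.
  intros He Hb u v e Hu Hv H. unfold right_defect.
  pose proof (H T ltac:(lra)) as H0.
  assert (H1 : Rabs (RInt (fun t => u t - v t) 0 eta) <= eta * e).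
  { eapply Rle_trans; [apply (RInt_abs_le _ 0 eta e)|].
    - now apply cts_minus.
    - intros t Ht. apply H. apply (between_in 0 eta 0 T t); lra.
    - rewrite Rminus_0_r, Rabs_pos_eq; lra. }
  rewrite RInt_minus_R in H1 by assumption.
  apply Rabs_le_between in H0, H1. apply Rabs_le. nra.
Qed.

(* Twice the determinant of the two boundary functionals on affine functions. *)
Definition bvp_det (T eta alpha beta : R) : R :=
  2 * T - alpha * eta ^ 2 - beta * (alpha * eta ^ 2 - 2 * eta + 2 * T).

(** [par_beta_eta] makes the left defect of a steep increasing line negative; [par_det] is the upper
    bound on [beta] with its denominator cleared. *)
Record parameters (T eta alpha beta : R) : Prop := {
  par_eta : 0 < eta < T;
  par_alpha : 0 < alpha;
  par_beta : 0 <= beta;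
  par_alpha_eta : alpha * eta ^ 2 < 2 * T;
  par_beta_eta : beta * (T - eta) < T;
  par_det : 0 < bvp_det T eta alpha beta
}.

Lemma parameters_intro T eta alpha beta :
  0 < eta < T -> 0 < alpha < 2 * T / eta ^ 2 ->
  0 <= beta < (2 * T - alpha * eta ^ 2) / (alpha * eta ^ 2 - 2 * eta + 2 * T) ->
  parameters T eta alpha beta.
Proof.
  intros He [Ha Ha'] [Hb Hb'].
  assert (He2 : 0 < eta ^ 2) by nra.
  apply Rlt_div_r in Ha'; [|exact He2].
  assert (Haa : 0 < alpha * eta ^ 2) by nra.
  apply Rlt_div_r in Hb'; [|lra].
  split; auto; try lra.
  - nra.
  - unfold bvp_det. lra.
Qed.

(** For [tau = - L] the trajectory starts at [m > 0] and has fallen to at most [0] at [eta]. For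
    [tau = T + L] the affine part contributes [- L * (T - beta * (T - eta))], which outweighs [m]
    and the integral terms. *)
Lemma left_defect_signs T eta alpha beta L B hi m y :
  parameters T eta alpha beta -> 0 < m <= hi -> hi <= L * eta ->
  hi + beta * (T * (T * B)) < L * (T - beta * (T - eta)) -> cts y -> (forall x, 0 <= y x <= B) ->
  0 < left_defect eta beta (shoot T m (- L) y) /\ left_defect eta beta (shoot T m (T + L) y) < 0.
Proof.
  intros [He Ha Hb Hae Hbe HD] Hm HL1 HL2 Hy HB. unfold left_defect, shoot.
  assert (HL : 0 < L) by nra.
  assert (HB0 : 0 <= B) by (specialize (HB 0); lra).
  assert (C0 : clamp 0 T (- L) = 0)
    by (unfold clamp, Rmax, Rmin; repeat destruct Rle_dec; lra).
  assert (CT : clamp 0 T (T + L) = T)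
    by (unfold clamp, Rmax, Rmin; repeat destruct Rle_dec; lra).
  rewrite C0, CT, RInt_point.
  assert (H : forall x, 0 <= y x) by apply HB.
  pose proof (kernel_nonneg y 0 eta Hy H).
  pose proof (kernel_nonneg y T 0 Hy H).
  assert (B1 : Rabs (RInt (fun s => (eta - s) * y s) T eta) <= T * (T * B)).
  { eapply Rle_trans; [apply (RInt_abs_le _ T eta (T * B)); [now apply cts_kernel|]|].
    - intros x Hx. rewrite Rabs_mult, (Rabs_pos_eq (y x)) by apply HB.
      apply Rmult_le_compat; try apply Rabs_pos; try apply HB.
      apply dist_in; [lra|]. apply (between_in T eta); try lra.
    - apply Rmult_le_compat_r; [nra|apply dist_in; lra]. }
  apply Rabs_le_between in B1.
  unfold zero; simpl. split; nra.
Qed.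

(* The values at [0] and at [T] of the affine part dominate the trajectory. *)
Lemma peak_strict_bound T eta alpha beta A d c i iT K Ic rho :
  parameters T eta alpha beta -> 0 < rho -> 0 <= c <= T ->
  0 <= i -> 0 <= iT -> 0 <= K -> 0 <= Ic -> (c = T -> Ic = iT) ->
  A = beta * (A + d * eta - i) ->
  A + d * T - iT <= alpha * (A * eta + d * eta ^ 2 / 2 - K) ->
  rho = A + d * c - Ic ->
  2 * (beta + 1) * T * iT <= rho * bvp_det T eta alpha beta -> False.
Proof.
  intros [He Ha Hb Hae Hbe HD] Hrho Hc Hi HiT HK HIc HcT HP HQ Hpeak Hbound.
  set (D := bvp_det T eta alpha beta) in *.
  (* Cramer's rule: [E1] and [E2] solve the two boundary relations for the values of the affine part
     at [0] and at [T]. *)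
  assert (E1 : A * D = 2 * (beta * eta) * (A + d * T - alpha * (A * eta + d * eta ^ 2 / 2))
    - beta * i * (2 * T - alpha * eta ^ 2)).
  { assert (E : beta * eta * d = A - beta * A + beta * i) by lra.
    replace (2 * (beta * eta) * (A + d * T - alpha * (A * eta + d * eta ^ 2 / 2)))
      with (2 * (beta * eta) * (A - alpha * A * eta) + (beta * eta * d) * (2 * T - alpha * eta ^ 2))
      by field.
    rewrite E. unfold D, bvp_det. ring. }
  assert (E2 : (A + d * T) * D =
    2 * (beta * eta + T - beta * T) * (A + d * T - alpha * (A * eta + d * eta ^ 2 / 2))
    + beta * i * (alpha * eta ^ 2 - 2 * alpha * eta * T)).
  { assert (E : A = beta * A + beta * d * eta - beta * i) by lra.
    assert (E' : beta * i = beta * A + beta * d * eta - A) by lra.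
    rewrite E'. unfold D, bvp_det. field. }
  assert (Hq : A + d * T - alpha * (A * eta + d * eta ^ 2 / 2) <= iT).
  { assert (0 <= alpha * K) by nra. lra. }
  assert (Hbi : 0 <= beta * i) by nra.
  assert (H1 : A * D <= 2 * (beta * eta) * iT).
  { assert (0 <= beta * eta) by nra. nra. }
  assert (H2 : (A + d * T) * D <= 2 * T * iT).
  { assert (alpha * eta ^ 2 - 2 * alpha * eta * T <= 0).
    { assert (alpha * eta * (eta - 2 * T) <= 0) by (assert (0 < alpha * eta) by nra; nra). nra. }
    assert (0 < beta * eta + T - beta * T) by nra.
    assert (beta * eta + T - beta * T <= T) by nra. nra. }
  assert (Hpos : 0 < rho * D) by nra.
  (* The affine part at the peak is a convex combination of its endpoint values, whose bounds carry
     the coefficients [2 * (beta * eta)] and [2 * T]; both are at most [2 * (beta + 1) * T], the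
     constant in the hypothesis. *)
  assert (Hc2 : T * (rho * D) <= (T - c) * (2 * (beta * eta) * iT) + c * (2 * T * iT) - T * Ic * D).
  { rewrite Hpeak.
    replace (T * ((A + d * c - Ic) * D)) with ((T - c) * (A * D) + c * ((A + d * T) * D) - T * Ic * D)
      by ring. nra. }
  assert (HIcD : 0 <= T * Ic * D) by (apply Rmult_le_pos; [nra|lra]).
  assert (HiTp : 0 < iT).
  { destruct (Rle_lt_or_eq_dec _ _ HiT) as [Hlt|Heq]; [exact Hlt|]. rewrite <- Heq in Hc2. nra. }
  (* Strictness has two sources: for [c < T] the weight of the value at [0] is positive and
     [beta * eta < (beta + 1) * T]; for [c = T] the subtracted integral is [iT > 0]. *)
  destruct (Rle_lt_or_eq_dec c T ltac:(lra)) as [Hlt|Heq].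
  - assert ((T - c) * (2 * (beta * eta) * iT) < (T - c) * (2 * (beta + 1) * T * iT)).
    { apply Rmult_lt_compat_l; [lra|]. apply Rmult_lt_compat_r; [exact HiTp|]. nra. }
    assert (c * (2 * T * iT) <= c * (2 * (beta + 1) * T * iT)).
    { apply Rmult_le_compat_l; [lra|]. apply Rmult_le_compat_r; [lra|]. nra. }
    nra.
  - rewrite (HcT Heq), Heq in Hc2.
    assert (0 < T * iT * D) by (apply Rmult_lt_0_compat; [nra|exact HD]).
    assert (T * (2 * T * iT) <= T * (2 * (beta + 1) * T * iT)).
    { apply Rmult_le_compat_l; [lra|]. apply Rmult_le_compat_r; [lra|]. nra. }
    nra.
Qed.

(** The trajectory is an affine function minus the nonnegative double integral [I] of the forcing.
    If the right defect were nonpositive, [peak_strict_bound] at the peak would contradict the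
    smallness of [I T]. *)
Lemma right_defect_pos_of_small T eta alpha beta m tau y w :
  parameters T eta alpha beta -> 0 < m -> cts y -> (forall x, 0 <= y x) ->
  RInt (fun s => (T - s) * y s) 0 T <= w -> 2 * (beta + 1) * T * w <= m * bvp_det T eta alpha beta ->
  left_defect eta beta (shoot T m tau y) = 0 ->
  0 < right_defect T eta alpha (shoot T m tau y).
Proof.
  intros HP Hm Hy H Hw Hw2 HL. pose proof (par_eta _ _ _ _ HP) as He.
  pose proof (par_beta _ _ _ _ HP) as Hb.
  apply Rnot_le_lt. intros HQ. unfold left_defect in HL. unfold right_defect in HQ.
  set (u := shoot T m tau y) in *. set (c := clamp 0 T tau).
  set (I := fun t => RInt (fun s => (t - s) * y s) 0 t).
  set (d := slope T tau y 0).
  assert (Eu : forall t, u t = u 0 + d * t - I t).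
  { intros t. unfold u. rewrite (shoot_taylor T m tau y 0 t Hy). fold d. unfold I. ring. }
  assert (HI : forall t, 0 <= I t) by (intros t; exact (kernel_nonneg y 0 t Hy H)).
  assert (Cu : cts u) by now apply cts_shoot.
  assert (CI : cts I).
  { apply (cts_ext (fun t => (u 0 + d * t) - u t)); [intros t; rewrite (Eu t); ring|].
    apply cts_minus; [|exact Cu].
    apply cts_plus; [apply cts_const|apply cts_mult; [apply cts_const|apply cts_id]]. }
  assert (EInt : @eq R (RInt u 0 eta) (u 0 * eta + d * eta ^ 2 / 2 - RInt I 0 eta)).
  { rewrite (RInt_ext_R u (fun t => (u 0 + d * t) - I t)) by (intros; apply Eu).
    rewrite RInt_minus_R; [|apply cts_plus; [apply cts_const|apply cts_mult; [apply cts_const|apply cts_id]]|exact CI].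
    rewrite RInt_affine. field. }
  apply (peak_strict_bound T eta alpha beta (u 0) d c (I eta) (I T) (RInt I 0 eta) (I c) m); auto.
  - apply clamp_in; lra.
  - apply RInt_pos; auto; lra.
  - intros E; now rewrite E.
  - rewrite (Eu eta) in HL. lra.
  - rewrite EInt, (Eu T) in HQ. lra.
  - rewrite <- (shoot_peak T m tau y) at 1. fold c. fold u. apply Eu.
  - apply Rle_trans with (2 := Hw2). apply Rmult_le_compat_l; [nra|exact Hw].
Qed.

(** Concavity compares the trajectory with its chords. Only a nonnegative right defect is assumed,
    so the estimates serve both for actual solutions and in proofs by contradiction of a negative
    defect. *)
Lemma boundary_shape T eta alpha beta m tau y :
  parameters T eta alpha beta -> cts y -> (forall x, 0 <= y x) ->
  let u := shoot T m tau y in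
  left_defect eta beta u = 0 -> 0 <= right_defect T eta alpha u ->
  0 <= u eta /\ (forall t, 0 <= t <= T -> 0 <= u t) /\
  (forall t, 0 <= t <= eta -> t * u eta <= eta * u t) /\
  (forall t, eta <= t <= T -> (T - t) * u eta <= (T - eta) * u t) /\
  Rmin eta (T - eta) * m <= T * u eta /\
  alpha * (eta * (beta + 1) * u eta / 2) <= u T.
Proof.
  intros HP Hy H u HL HQ. destruct HP as [He Ha Hb Hae Hbe HD].
  unfold left_defect in HL. unfold right_defect in HQ.
  assert (Cu : cts u) by now apply cts_shoot.
  assert (Conc : forall a b c, a <= b <= c -> (c - b) * u a + (b - a) * u c <= (c - a) * u b)
    by (intros; now apply shoot_concave).
  set (v := u eta) in *.
  (* The integral is bounded below by that of the chord over [[0, eta]], whose end values are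
     [beta * v] and [v]. *)
  assert (HI : eta * (beta + 1) * v / 2 <= RInt u 0 eta).
  { apply Rle_trans with (RInt (fun t => beta * v + (v - beta * v) / eta * t) 0 eta).
    - rewrite RInt_affine. right. field. lra.
    - apply RInt_le_cts; auto; [|lra|].
      + apply cts_plus; [apply cts_const|apply cts_mult; [apply cts_const|apply cts_id]].
      + intros t Ht. pose proof (Conc 0 t eta Ht) as C. fold v in C.
        apply Rmult_le_reg_l with eta; [lra|].
        replace (eta * (beta * v + (v - beta * v) / eta * t))
          with ((eta - t) * (beta * v) + t * v) by (field; lra).
        replace (u 0) with (beta * v) in C by lra. lra. }
  pose proof (Conc 0 eta T ltac:(lra)) as C1. fold v in C1.
  assert (HT : alpha * (eta * (beta + 1) * v / 2) <= u T).
  { apply Rle_trans with (alpha * RInt u 0 eta); [|lra]. apply Rmult_le_compat_l; lra. }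
  assert (Hv : 0 <= v).
  { assert (H1 : 0 <= v * (bvp_det T eta alpha beta / 2)).
    { replace (u 0) with (beta * v) in C1 by lra.
      assert (eta * (alpha * (eta * (beta + 1) * v / 2)) <= eta * u T)
        by (apply Rmult_le_compat_l; lra).
      unfold bvp_det. lra. }
    apply Rnot_lt_le. intros Hlt. nra. }
  assert (Hu0 : 0 <= u 0) by nra.
  assert (HuT : 0 <= u T).
  { apply Rle_trans with (2 := HT). apply Rmult_le_pos; [lra|].
    assert (0 <= eta * (beta + 1)) by nra. nra. }
  split; [exact Hv|]. split; [|split; [|split; [|split]]].
  - intros t Ht. pose proof (Conc 0 t T Ht).
    assert (0 <= (T - t) * u 0) by nra. assert (0 <= t * u T) by nra. nra.
  - intros t Ht. pose proof (Conc 0 t eta Ht) as C. fold v in C.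
    assert (0 <= (eta - t) * u 0) by nra. lra.
  - intros t Ht. pose proof (Conc eta t T Ht) as C. fold v in C.
    assert (0 <= (t - eta) * u T) by nra. lra.
  - rewrite <- (shoot_peak T m tau y). fold u. set (c := clamp 0 T tau).
    assert (Hc : 0 <= c <= T) by (apply clamp_in; lra).
    pose proof (Rmin_l eta (T - eta)). pose proof (Rmin_r eta (T - eta)).
    assert (Huc : 0 <= u c).
    { pose proof (Conc 0 c T Hc).
      assert (0 <= (T - c) * u 0) by nra. assert (0 <= c * u T) by nra. nra. }
    destruct (Rle_dec c eta) as [Hce|Hce].
    + pose proof (Conc c eta T ltac:(lra)) as C. fold v in C.
      assert (0 <= (eta - c) * u T) by nra. nra.
    + pose proof (Conc 0 eta c ltac:(lra)) as C. fold v in C.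
      assert (0 <= (c - eta) * u 0) by nra. nra.
  - exact HT.
Qed.

(** The tangent at [eta], evaluated at [0], bounds the slope there by [(1 - beta) * v / eta].
    Substituting this in the Taylor formula at [T], with the lower bound for [u T], gives half the
    determinant times [v = u eta <= m]. *)
Lemma forcing_le T eta alpha beta m tau y :
  parameters T eta alpha beta -> cts y -> (forall x, 0 <= y x) ->
  left_defect eta beta (shoot T m tau y) = 0 ->
  0 <= right_defect T eta alpha (shoot T m tau y) ->
  eta * RInt (fun s => (T - s) * y s) eta T <= m * (bvp_det T eta alpha beta / 2).
Proof.
  intros HP Hy H HL HQ.
  destruct (boundary_shape T eta alpha beta m tau y HP Hy H HL HQ)
    as [Hv [_ [_ [_ [_ HT]]]]].
  destruct HP as [He Ha Hb Hae Hbe HD].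
  pose proof (shoot_le_peak T m tau y eta ltac:(lra) Hy H ltac:(lra)) as Hm.
  pose proof (shoot_taylor T m tau y eta T Hy) as E1.
  pose proof (shoot_tangent T m tau y eta 0 Hy H) as E2.
  unfold left_defect in HL.
  set (u := shoot T m tau y) in *. set (v := u eta) in *.
  apply Rle_trans with (v * (bvp_det T eta alpha beta / 2)); [|nra].
  set (J := RInt _ eta T) in *. set (p := slope T tau y eta) in *.
  assert (E3 : eta * p <= v - beta * v) by lra.
  assert (eta * p * (T - eta) <= (v - beta * v) * (T - eta)) by (apply Rmult_le_compat_r; lra).
  assert (eta * (alpha * (eta * (beta + 1) * v / 2)) <= eta * u T)
    by (apply Rmult_le_compat_l; lra).
  rewrite E1 in H1. unfold bvp_det. lra.
Qed.

(** The interval stays away from [T], where the weight [T - s] vanishes; this is why it is taken to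
    the left of [t0] when [t0] is close to [T]. *)
Lemma positive_interval (A : R -> R) eta T t0 :
  cts A -> eta < T -> eta <= t0 <= T -> 0 < A t0 ->
  exists t1 t2 a0, eta <= t1 < t2 /\ t2 < T /\ 0 < a0 /\ forall t, t1 <= t <= t2 -> a0 <= A t.
Proof.
  intros HA HeT Ht0 Hpos.
  assert (Hc : continuity_pt A t0) by (apply continuity_pt_filterlim, HA).
  destruct (Hc (A t0 / 2) ltac:(lra)) as [r [Hr Kr]]. simpl in Kr. unfold R_dist in Kr.
  assert (HAt : forall t, Rabs (t - t0) < r -> A t0 / 2 <= A t).
  { intros t Ht. destruct (Req_dec t t0) as [->|Hne]; [lra|].
    assert (Hd : Rabs (A t - A t0) < A t0 / 2).
    { apply Kr. split; [split; [exact I|auto]|exact Ht]. }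
    apply Rabs_lt_between in Hd. lra. }
  set (q := Rmin r ((T - eta) / 2) / 2).
  assert (Hq : 0 < q /\ 2 * q <= r /\ 2 * q <= (T - eta) / 2).
  { unfold q. pose proof (Rmin_l r ((T - eta) / 2)). pose proof (Rmin_r r ((T - eta) / 2)).
    assert (0 < Rmin r ((T - eta) / 2)) by (apply Rmin_pos; lra). lra. }
  destruct (Rle_dec ((eta + T) / 2) t0) as [Hle|Hle].
  - exists (t0 - 3 / 2 * q), (t0 - q), (A t0 / 2). repeat split; try lra.
    intros t Ht. apply HAt. apply Rabs_def1; lra.
  - exists t0, (t0 + q), (A t0 / 2). repeat split; try lra.
    intros t Ht. apply HAt. apply Rabs_def1; lra.
Qed.

(** A nonnegative defect keeps the trajectory above [sg * m] on an interval where [A] is bounded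
    below, so superlinear growth makes the forcing exceed [forcing_le]. The constants do not depend
    on [m], so one pair serves for small and for large maxima. *)
Lemma right_defect_neg_of_superlinear T eta alpha beta (A : R -> R) t0 :
  parameters T eta alpha beta -> cts A -> eta <= t0 <= T -> 0 < A t0 ->
  exists Lc sg, 0 < Lc /\ 0 < sg /\ forall m tau y F,
    0 < m -> cts y -> (forall x, 0 <= y x) ->
    (forall s, 0 <= s <= T -> y s = A s * F (shoot T m tau y s)) ->
    (forall x, sg * m <= x <= m -> Lc * x <= F x) ->
    left_defect eta beta (shoot T m tau y) = 0 ->
    right_defect T eta alpha (shoot T m tau y) < 0.
Proof.
  intros HP HA Ht0 Hpos.
  pose proof (par_eta _ _ _ _ HP) as He. pose proof (par_det _ _ _ _ HP) as HD.
  destruct (positive_interval A eta T t0 HA ltac:(lra) Ht0 Hpos)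
    as [t1 [t2 [a0 [Ht1 [Ht2 [Ha0 HAt]]]]]].
  set (mu := Rmin eta (T - eta)).
  assert (Hmu : 0 < mu) by (apply Rmin_pos; lra).
  set (sg := mu * (T - t2) / (T * (T - eta))).
  assert (HTe : 0 < T * (T - eta)) by (apply Rmult_lt_0_compat; lra).
  assert (Hsg : 0 < sg) by (apply Rdiv_lt_0_compat; [apply Rmult_lt_0_compat; lra|exact HTe]).
  set (ka := eta * ((t2 - t1) * ((T - t2) * a0))).
  assert (Hka : 0 < ka) by (unfold ka; repeat apply Rmult_lt_0_compat; lra).
  (* Chosen so that [ka * Lc * sg] is the whole determinant, twice what [forcing_le] allows. *)
  set (Lc := bvp_det T eta alpha beta / (ka * sg)).
  assert (Hks : 0 < ka * sg) by (apply Rmult_lt_0_compat; lra).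
  assert (HLc : 0 < Lc) by (apply Rdiv_lt_0_compat; lra).
  exists Lc, sg. split; [exact HLc|]. split; [exact Hsg|].
  intros m tau y F Hm Hy H Ey HF HL. apply Rnot_le_lt. intros HQ.
  destruct (boundary_shape T eta alpha beta m tau y HP Hy H HL HQ)
    as [Hv [Hu [_ [Hr [Hmv _]]]]].
  pose proof (forcing_le T eta alpha beta m tau y HP Hy H HL HQ) as HJ.
  set (u := shoot T m tau y) in *. fold mu in Hmv.
  assert (Hlow : forall t, t1 <= t <= t2 -> sg * m <= u t).
  { intros t Ht. specialize (Hr t ltac:(lra)).
    apply Rmult_le_reg_l with (T * (T - eta)); [exact HTe|].
    replace (T * (T - eta) * (sg * m)) with ((T - t2) * (mu * m)) by (unfold sg; field; lra).
    apply Rle_trans with ((T - t2) * (T * u eta)); [apply Rmult_le_compat_l; lra|].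
    apply Rle_trans with (T * ((T - t) * u eta)).
    - replace ((T - t2) * (T * u eta)) with (T * ((T - t2) * u eta)) by ring.
      apply Rmult_le_compat_l; [lra|]. apply Rmult_le_compat_r; lra.
    - replace (T * (T - eta) * u t) with (T * ((T - eta) * u t)) by ring.
      apply Rmult_le_compat_l; lra. }
  assert (Hy1 : forall t, t1 <= t <= t2 -> (T - t2) * a0 * (Lc * (sg * m)) <= (T - t) * y t).
  { intros t Ht. rewrite Ey by lra. fold u. specialize (Hlow t Ht).
    assert (u t <= m) by (apply shoot_le_peak; auto; lra).
    assert (HFt : Lc * (sg * m) <= F (u t)).
    { apply Rle_trans with (Lc * u t); [apply Rmult_le_compat_l; lra|]. apply HF; lra. }
    assert (0 <= Lc * (sg * m)) by (apply Rmult_le_pos; [lra|apply Rmult_le_pos; lra]).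
    rewrite Rmult_assoc. apply Rmult_le_compat; try lra.
    - apply Rmult_le_pos; lra.
    - apply Rmult_le_compat; try lra. now apply HAt. }
  assert (HJ2 : (t2 - t1) * ((T - t2) * a0 * (Lc * (sg * m))) <= RInt (fun s => (T - s) * y s) eta T).
  { pose proof (cts_kernel y T Hy) as Ck.
    assert (Hnn : forall t, t <= T -> 0 <= (T - t) * y t) by (intros; apply Rmult_le_pos; [lra|apply H]).
    rewrite (RInt_Chasles_R _ eta t1 T Ck), (RInt_Chasles_R _ t1 t2 T Ck).
    assert (0 <= RInt (fun s => (T - s) * y s) eta t1)
      by (apply RInt_pos; auto; [lra|intros; apply Hnn; lra]).
    assert (0 <= RInt (fun s => (T - s) * y s) t2 T)
      by (apply RInt_pos; auto; [lra|intros; apply Hnn; lra]).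
    assert (RInt (fun _ => (T - t2) * a0 * (Lc * (sg * m))) t1 t2 <= RInt (fun s => (T - s) * y s) t1 t2)
      by (apply RInt_le_cts; auto; [apply cts_const|lra]).
    rewrite RInt_const in H2. unfold scal in H2; simpl in H2; unfold mult in H2; simpl in H2. lra. }
  assert (HJ3 : ka * (Lc * (sg * m)) <= eta * RInt (fun s => (T - s) * y s) eta T).
  { replace (ka * (Lc * (sg * m))) with (eta * ((t2 - t1) * ((T - t2) * a0 * (Lc * (sg * m)))))
      by (unfold ka; ring). apply Rmult_le_compat_l; lra. }
  replace (ka * (Lc * (sg * m))) with (m * bvp_det T eta alpha beta) in HJ3
    by (unfold Lc; field; lra).
  assert (0 < m * bvp_det T eta alpha beta) by (apply Rmult_lt_0_compat; lra). lra.
Qed.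

(** * Positive solutions *)

Lemma clamp_comp_bounded (g : R -> R) lo hi :
  lo <= hi -> cts (fun x => g (clamp lo hi x)) -> exists M, forall x, g (clamp lo hi x) <= M.
Proof.
  intros Hlh Hg.
  destruct (continuity_ab_maj (fun x => g (clamp lo hi x)) lo hi Hlh) as [z [Hz _]].
  - intros c _. apply continuity_pt_filterlim, Hg.
  - exists (g (clamp lo hi z)). intros x.
    pose proof (Hz (clamp lo hi x) ltac:(now apply clamp_in)) as H. simpl in H.
    now rewrite (clamp_id lo hi (clamp lo hi x)) in H by now apply clamp_in.
Qed.

Lemma sup_norm_eq T u m t0 :
  (forall t, 0 <= t <= T -> 0 <= u t <= m) -> 0 <= t0 <= T -> u t0 = m -> sup_norm T u = m.
Proof.
  intros Hu Ht0 Em. unfold sup_norm.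
  rewrite (is_lub_Rbar_unique _ (Finite m)); [reflexivity|]. split.
  - intros y [t [Ht ->]]. simpl. rewrite Rabs_pos_eq; apply Hu, Ht.
  - intros b Hb. apply (Hb m). exists t0. split; [exact Ht0|].
    rewrite Rabs_pos_eq; [now symmetry|apply Hu, Ht0].
Qed.

Lemma shoot_positive_solution T eta alpha beta a f m tau y :
  parameters T eta alpha beta -> 0 < m -> cts y -> (forall x, 0 <= y x) ->
  (forall t, 0 < t < T -> y t = a t * f (shoot T m tau y t)) ->
  left_defect eta beta (shoot T m tau y) = 0 ->
  right_defect T eta alpha (shoot T m tau y) = 0 ->
  is_positive_solution T eta alpha beta a f (shoot T m tau y) /\
  sup_norm T (shoot T m tau y) = m.
Proof.
  intros HP Hm Hy H Ey HL HR.
  destruct (boundary_shape T eta alpha beta m tau y HP Hy H HL ltac:(lra))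
    as [Hv [Hu [Hl [Hr [Hmv _]]]]].
  pose proof (par_eta _ _ _ _ HP) as He.
  set (u := shoot T m tau y) in *.
  assert (Cu : cts u) by now apply cts_shoot.
  assert (D1 : forall t, Derive u t = tau - clamp 0 T tau - RInt y (clamp 0 T tau) t)
    by (intros t; apply is_derive_unique; now apply is_derive_shoot).
  assert (D2' : forall t, is_derive (Derive u) t (- y t)).
  { intros t. apply is_derive_ext with (fun t => tau - clamp 0 T tau - RInt y (clamp 0 T tau) t).
    - intros s. now rewrite D1.
    - replace (- y t) with (0 - y t) by ring.
      apply (is_derive_minus (fun _ => tau - clamp 0 T tau) (fun t => RInt y (clamp 0 T tau) t));
        [apply @is_derive_const|now apply is_derive_RInt_cts]. }
  assert (D2 : forall t, Derive_n u 2 t = - y t)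
    by (intros t; exact (is_derive_unique _ _ _ (D2' t))).
  (* Strict positivity inside the interval follows from that at [eta] through the linear lower
     bounds [Hl] and [Hr]. *)
  assert (Hvpos : 0 < u eta).
  { assert (0 < Rmin eta (T - eta) * m).
    { apply Rmult_lt_0_compat; [apply Rmin_pos; lra|exact Hm]. }
    apply Rnot_le_lt. intros Hle. assert (T * u eta <= 0) by nra. lra. }
  split.
  - split; [|split].
    + split; [|split; [|split; [|split]]].
      * intros t _ P HP'. apply filter_le_within. exact (Cu t P HP').
      * intros t _. split; [eexists; now apply is_derive_shoot|].
        split; [eexists; apply D2'|].
        apply (cts_ext (fun t => 0 - y t)); [intros s; rewrite D2; ring|].
        apply cts_minus; [apply cts_const|exact Hy].
      * intros t Ht. rewrite D2, Ey by exact Ht. ring.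
      * unfold left_defect in HL. lra.
      * unfold right_defect in HR. lra.
    + intros t Ht. apply Hu, Ht.
    + intros t Ht. destruct (Rle_dec t eta).
      * specialize (Hl t ltac:(lra)). assert (0 < t * u eta) by nra.
        apply Rnot_le_lt. intros Hle. nra.
      * specialize (Hr t ltac:(lra)). assert (0 < (T - t) * u eta) by nra.
        apply Rnot_le_lt. intros Hle. nra.
  - apply (sup_norm_eq T u m (clamp 0 T tau)).
    + intros t Ht. split; [apply Hu, Ht|]. apply shoot_le_peak; auto; lra.
    + apply clamp_in; lra.
    + apply shoot_peak.
Qed.

(** The equation with truncated data: clamping values to [[0, hi]] keeps [f] within its domain and
    bounded. Solutions lie in that range, so the truncation disappears afterwards. *)
Definition forced (T hi : R) (a f : R -> R) (m tau : R) (y : R -> R) : Prop :=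
  cts y /\ (forall x, 0 <= y x) /\
  forall s, 0 <= s <= T ->
    y s = a (clamp 0 T s) * f (clamp 0 hi (shoot T m tau y s)).

(** The sign [sg] covers both orders in which the right defect changes sign between [lo] and
    [hi]. *)
Lemma solution_between T eta alpha beta a f lo hi sg :
  parameters T eta alpha beta ->
  continuous_on (Icc 0 T) a -> (forall t, Icc 0 T t -> 0 <= a t) ->
  continuous_on (Ici 0) f -> (forall x, Ici 0 x -> 0 <= f x) ->
  0 < lo < hi -> sg = 1 \/ sg = -1 ->
  (forall tau y, forced T hi a f lo tau y -> left_defect eta beta (shoot T lo tau y) = 0 ->
     sg * right_defect T eta alpha (shoot T lo tau y) < 0) ->
  (forall tau y, forced T hi a f hi tau y -> left_defect eta beta (shoot T hi tau y) = 0 ->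
     0 < sg * right_defect T eta alpha (shoot T hi tau y)) ->
  exists u, is_positive_solution T eta alpha beta a f u /\ lo < sup_norm T u < hi.
Proof.
  intros HP Ca Pa Cf Pf Hlh Hsg Hlo Hhi.
  pose proof HP as [He Ha Hb Hae Hbe HD].
  set (A := fun t => a (clamp 0 T t)). set (F := fun x => f (clamp 0 hi x)).
  assert (CA : cts A) by (apply (cts_clamp_comp 0 T a (Icc 0 T)); auto; lra).
  assert (CF : cts F).
  { apply (cts_clamp_comp 0 hi f (Ici 0)); auto; [lra|]. intros x Hx. apply Hx. }
  assert (PA : forall t, 0 <= A t) by (intros t; apply Pa, clamp_in; lra).
  assert (PF : forall x, 0 <= F x) by (intros x; apply Pf, (clamp_in 0 hi); lra).
  destruct (clamp_comp_bounded a 0 T ltac:(lra) CA) as [Am HAm].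
  destruct (clamp_comp_bounded f 0 hi ltac:(lra) CF) as [Fm HFm].
  set (B := Am * Fm).
  assert (HA : admissible B Am A F).
  { split; auto.
    - intros s. split; [apply PA|apply HAm].
    - intros s x. split; [apply Rmult_le_pos; [apply PA|apply PF]|].
      apply Rmult_le_compat; [apply PA|apply PF|apply HAm|apply HFm].
    - intros e He'. destruct (cts_clamp_unif 0 hi F ltac:(lra) CF e He') as [d [Hd K]].
      exists d. split; [exact Hd|]. intros x y Hxy. specialize (K x y Hxy). unfold F in *.
      now rewrite !(clamp_id 0 hi (clamp 0 hi _)) in K by (apply clamp_in; lra). }
  pose proof (adm_B_nonneg _ _ _ _ HA) as HB0.
  (* The first summand meets the first requirement of [left_defect_signs], the second meets the
     other, strictly because of the [+ 1]. *)
  set (L := hi / eta + (hi + beta * (T * (T * B)) + 1) / (T - beta * (T - eta))).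
  assert (H1 : 0 < hi / eta) by (apply Rdiv_lt_0_compat; lra).
  assert (HTTB : 0 <= beta * (T * (T * B))).
  { apply Rmult_le_pos; [exact Hb|]. apply Rmult_le_pos; [lra|]. apply Rmult_le_pos; lra. }
  assert (H2 : 0 < (hi + beta * (T * (T * B)) + 1) / (T - beta * (T - eta)))
    by (apply Rdiv_lt_0_compat; lra).
  assert (HL1 : hi <= L * eta).
  { assert (hi / eta * eta = hi) by (field; lra). unfold L. nra. }
  assert (HL2 : hi + beta * (T * (T * B)) < L * (T - beta * (T - eta))).
  { assert ((hi + beta * (T * (T * B)) + 1) / (T - beta * (T - eta)) * (T - beta * (T - eta))
      = hi + beta * (T * (T * B)) + 1) by (field; lra).
    assert (0 < hi / eta * (T - beta * (T - eta))) by (apply Rmult_lt_0_compat; lra).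
    unfold L. lra. }
  destruct (exact_solution T L B Am A F (1 + beta) (1 + alpha * eta)
    (left_defect eta beta) (fun u => sg * right_defect T eta alpha u) lo hi)
    as [m [tau [y [Hm [Cy [By [Ey [HL Hc]]]]]]]]; auto.
  - lra.
  - unfold L; lra.
  - lra.
  - nra.
  - apply left_defect_lipschitz; auto.
  - intros u v e Hu Hv Huv.
    pose proof (right_defect_lipschitz T eta alpha He ltac:(lra) u v e Hu Hv Huv) as H.
    apply Rabs_le_between in H. apply Rabs_le. destruct Hsg as [-> | ->]; lra.
  - intros m y Hm Cy By. apply (left_defect_signs T eta alpha beta L B hi); auto. lra.
  - assert (Hf : forced T hi a f m tau y).
    { split; [exact Cy|]. split; [apply By|exact Ey]. }
    (* The equation and the left condition are now exact, so the strict signs at [lo] and [hi] apply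
       and exclude both extreme values of [m]. *)
    assert (H : right_defect T eta alpha (shoot T m tau y) = 0 /\ m <> lo /\ m <> hi).
    { assert (Klo : m = lo -> sg * right_defect T eta alpha (shoot T m tau y) < 0)
        by (intros ->; auto).
      assert (Khi : m = hi -> 0 < sg * right_defect T eta alpha (shoot T m tau y))
        by (intros ->; auto).
      destruct Hc as [Hc|[[E Hc]|[E Hc]]].
      - split; [destruct Hsg as [-> | ->]; lra|].
        split; intros E; [specialize (Klo E)|specialize (Khi E)]; lra.
      - specialize (Klo E). lra.
      - specialize (Khi E). lra. }
    destruct H as [HR [Nlo Nhi]].
    assert (Hu : forall t, 0 <= t <= T -> 0 <= shoot T m tau y t <= hi).
    { intros t Ht.
      destruct (boundary_shape T eta alpha beta m tau y HP Cy (fun x => proj1 (By x)) HL ltac:(lra))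
        as [_ [Hu _]].
      split; [apply Hu, Ht|]. apply Rle_trans with m; [|lra].
      apply shoot_le_peak; auto; [lra|apply By]. }
    exists (shoot T m tau y).
    destruct (shoot_positive_solution T eta alpha beta a f m tau y) as [Hsol Hnorm]; auto.
    + lra.
    + apply By.
    + intros t Ht. rewrite Ey by lra. unfold A, F.
      rewrite (clamp_id 0 T t), (clamp_id 0 hi) by (try apply Hu; lra). reflexivity.
    + split; [exact Hsol|]. rewrite Hnorm. lra.
Qed.

(** * Growth conditions on [f] *)

Lemma superlinear_at_0 (f : R -> R) Lc :
  filterlim (fun x => f x / x) (at_right 0) (Rbar_locally p_infty) ->
  exists r, 0 < r /\ forall x, 0 < x < r -> Lc * x <= f x.
Proof.
  intros Hf. assert (HM : Rbar_locally p_infty (fun z => Lc < z)) by (exists Lc; auto).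
  destruct (Hf _ HM) as [[r Hr] K]. exists r. split; [exact Hr|].
  intros x Hx. apply Rlt_le. apply Rlt_div_r; [lra|].
  apply K; [|lra].
  unfold ball; simpl; unfold AbsRing_ball, abs, minus, plus, opp; simpl.
  rewrite Ropp_0, Rplus_0_r, Rabs_pos_eq; lra.
Qed.

Lemma superlinear_at_infty (f : R -> R) Lc :
  is_lim (fun x => f x / x) p_infty p_infty ->
  exists X, 0 <= X /\ forall x, X < x -> Lc * x <= f x.
Proof.
  intros Hf. assert (HM : Rbar_locally p_infty (fun z => Lc < z)) by (exists Lc; auto).
  destruct (Hf _ HM) as [X K]. exists (Rmax 0 X). split; [apply Rmax_l|].
  intros x Hx. pose proof (Rmax_l 0 X). pose proof (Rmax_r 0 X).
  apply Rlt_le. apply Rlt_div_r; [lra|]. apply K. lra.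
Qed.

(** A trajectory of maximum [rho1] has its clamped values in [[0, rho1]], where [f <= M1 * rho1].
    The forcing integral is then at most [M1 * rho1 * W], which the definition of [Lambda1] makes
    small enough for [right_defect_pos_of_small]. *)
Lemma right_defect_pos_at_rho T eta alpha beta a f rho1 M1 hi tau y :
  parameters T eta alpha beta ->
  continuous_on (Icc 0 T) a -> (forall t, Icc 0 T t -> 0 <= a t) ->
  0 < rho1 <= hi -> 0 < M1 <= Lambda1 T eta alpha beta a ->
  (forall x, Icc 0 rho1 x -> f x <= M1 * rho1) ->
  forced T hi a f rho1 tau y -> left_defect eta beta (shoot T rho1 tau y) = 0 ->
  0 < right_defect T eta alpha (shoot T rho1 tau y).
Proof.
  intros HP Ca Pa Hrho HM Hf [Cy [Py Ey]] HL.
  pose proof HP as [He Ha Hb Hae Hbe HD].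
  set (A := fun t => a (clamp 0 T t)).
  assert (CA : cts A) by (apply (cts_clamp_comp 0 T a (Icc 0 T)); auto; lra).
  assert (PA : forall t, 0 <= A t) by (intros t; apply Pa, clamp_in; lra).
  set (W := RInt (fun s => (T - s) * A s) 0 T).
  assert (CAk : cts (fun s => (T - s) * A s)) by now apply cts_kernel.
  assert (EW : RInt (fun s => T * (T - s) * a s) 0 T = T * W).
  { unfold W. rewrite <- RInt_scal_R by exact CAk. apply RInt_ext_R.
    intros s Hs. unfold A. rewrite clamp_id by (apply (between_in 0 T); lra). ring. }
  assert (HW : 0 <= W).
  { apply RInt_pos; auto; [lra|]. intros t Ht. apply Rmult_le_pos; [lra|apply PA]. }
  apply (right_defect_pos_of_small T eta alpha beta rho1 tau y (M1 * rho1 * W)); auto; [lra| |].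
  - unfold W. rewrite <- RInt_scal_R by exact CAk.
    apply RInt_le_cts; [now apply cts_kernel| |lra|].
    + apply cts_mult; [apply cts_const|exact CAk].
    + intros t Ht. rewrite Ey by exact Ht. fold (A t).
      assert (Hc : f (clamp 0 hi (shoot T rho1 tau y t)) <= M1 * rho1).
      { apply Hf. pose proof (shoot_le_peak T rho1 tau y t ltac:(lra) Cy Py Ht).
        unfold Icc, clamp, Rmax, Rmin; repeat destruct Rle_dec; lra. }
      assert (H0 : 0 <= (T - t) * A t) by (apply Rmult_le_pos; [lra|apply PA]).
      apply (Rmult_le_compat_l _ _ _ H0) in Hc. lra.
  - unfold Lambda1 in HM. rewrite EW in HM. fold (bvp_det T eta alpha beta) in HM.
    set (D := bvp_det T eta alpha beta) in *.
    set (E := 2 * (beta + 1) + / T * beta * eta * (alpha * eta + 2) + alpha * beta * T) in *.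
    assert (HE : 2 * (beta + 1) <= E).
    { assert (HT : 0 < / T) by (apply Rinv_0_lt_compat; lra).
      assert (0 <= / T * beta * eta * (alpha * eta + 2)).
      { repeat apply Rmult_le_pos; try lra. assert (0 < alpha * eta) by nra. lra. }
      assert (0 <= alpha * beta * T) by (repeat apply Rmult_le_pos; lra).
      unfold E. lra. }
    assert (HTW : 0 <= T * W) by nra.
    assert (HEW : 0 <= E * (T * W)) by (apply Rmult_le_pos; lra).
    destruct (Rle_lt_or_eq_dec _ _ HEW) as [Hlt|Heq].
    + assert (HMD : M1 * (E * (T * W)) <= D) by (apply Rle_div_r; [lra|apply HM]).
      assert (H3 : 2 * (beta + 1) * (T * W) <= E * (T * W)) by (apply Rmult_le_compat_r; lra).
      assert (H4 : rho1 * M1 * (2 * (beta + 1) * (T * W)) <= rho1 * M1 * (E * (T * W))).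
      { apply Rmult_le_compat_l; [apply Rmult_le_pos; lra|exact H3]. }
      assert (H5 : rho1 * (M1 * (E * (T * W))) <= rho1 * D) by (apply Rmult_le_compat_l; lra).
      lra.
    + (* [x / 0 = 0] would give [Lambda1 = 0], against [0 < M1 <= Lambda1] *)
      exfalso. rewrite <- Heq in HM. unfold Rdiv in HM. rewrite Rinv_0 in HM. lra.
Qed.

Theorem theorem3p1 (T eta alpha beta : R) (f a : R -> R) (rho1 M1 : R)
  (Heta : 0 < eta < T)
  (Halpha : 0 < alpha < 2 * T / eta ^ 2)
  (Hbeta : 0 <= beta <
     (2 * T - alpha * eta ^ 2) / (alpha * eta ^ 2 - 2 * eta + 2 * T))
  (Hfcont : continuous_on (Ici 0) f)
  (Hfnonneg : forall x, Ici 0 x -> 0 <= f x)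
  (Hacont : continuous_on (Icc 0 T) a)
  (Hanonneg : forall t, Icc 0 T t -> 0 <= a t)
  (Hapos : exists t0, Icc eta T t0 /\ 0 < a t0)
  (Hf0 : filterlim (fun x => f x / x) (at_right 0) (Rbar_locally p_infty))
  (Hfinfty : is_lim (fun x => f x / x) p_infty p_infty)
  (Hrho1 : 0 < rho1)
  (HM1 : 0 < M1 <= Lambda1 T eta alpha beta a)
  (Hfbound : forall x, Icc 0 rho1 x -> f x <= M1 * rho1) :
  exists u1 u2 : R -> R,
    is_positive_solution T eta alpha beta a f u1 /\
    is_positive_solution T eta alpha beta a f u2 /\
    0 < sup_norm T u1 /\ sup_norm T u1 < rho1 /\ rho1 < sup_norm T u2.
Proof.
  pose proof (parameters_intro T eta alpha beta Heta Halpha Hbeta) as HP.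
  destruct Hapos as [t0 [Ht0 Hat0]].
  set (A := fun t => a (clamp 0 T t)).
  assert (CA : cts A) by (apply (cts_clamp_comp 0 T a (Icc 0 T)); auto; lra).
  assert (HAt0 : 0 < A t0) by (unfold A; rewrite clamp_id; [exact Hat0|unfold Icc in Ht0; lra]).
  destruct (right_defect_neg_of_superlinear T eta alpha beta A t0 HP CA Ht0 HAt0)
    as [Lc [sg [HLc [Hsg Hneg]]]].
  destruct (superlinear_at_0 f Lc Hf0) as [r0 [Hr0 K0]].
  destruct (superlinear_at_infty f Lc Hfinfty) as [X [HX K1]].
  (* The growth inequality is needed on the whole range from [sg * m] to [m]: [m = r] puts this
     range below [r0], and [m = q] puts it above [X]. *)
  set (r := Rmin r0 rho1 / 2).
  assert (Hr : 0 < r /\ r < r0 /\ r < rho1).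
  { unfold r. pose proof (Rmin_l r0 rho1). pose proof (Rmin_r r0 rho1).
    assert (0 < Rmin r0 rho1) by (apply Rmin_pos; lra). lra. }
  set (q := rho1 + 1 + (X + 1) / sg).
  assert (Hq : rho1 < q /\ X < sg * q).
  { assert (0 < (X + 1) / sg) by (apply Rdiv_lt_0_compat; lra).
    assert (sg * ((X + 1) / sg) = X + 1) by (field; lra).
    unfold q. split; [lra|]. assert (0 < sg * (rho1 + 1)) by (apply Rmult_lt_0_compat; lra). lra. }
  destruct (solution_between T eta alpha beta a f r rho1 1) as [u1 [S1 N1]]; auto.
  - lra.
  - intros tau y [Cy [Py Ey]] HL. rewrite Rmult_1_l.
    apply (Hneg r tau y (fun x => f (clamp 0 rho1 x))); auto; [lra|].
    intros x Hx. assert (0 < sg * r) by (apply Rmult_lt_0_compat; lra).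
    rewrite clamp_id by lra. apply K0. lra.
  - intros tau y Hf HL. rewrite Rmult_1_l.
    apply (right_defect_pos_at_rho T eta alpha beta a f rho1 M1 rho1); auto. lra.
  (* Above [rho1] the right defect passes from positive to negative, hence the sign [-1]. *)
  - destruct (solution_between T eta alpha beta a f rho1 q (-1)) as [u2 [S2 N2]]; auto.
    + lra.
    + intros tau y Hf HL.
      pose proof (right_defect_pos_at_rho T eta alpha beta a f rho1 M1 q tau y HP Hacont
        Hanonneg ltac:(lra) HM1 Hfbound Hf HL). lra.
    + intros tau y [Cy [Py Ey]] HL.
      assert (right_defect T eta alpha (shoot T q tau y) < 0); [|lra].
      apply (Hneg q tau y (fun x => f (clamp 0 q x))); auto; [lra|].
      intros x Hx. rewrite clamp_id by lra. apply K1. lra.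
    + exists u1, u2. split; [exact S1|]. split; [exact S2|]. lra.
Qed.
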